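(* Let $(M,g)$ be an $m$-dimensional Riemannian manifold, let $(TM,g_S)$ be its tangent bundle equipped with the Sasaki metric, and let $\delta_1,\delta_2\in\mathbb{R}$. If $X:(M,g)\to(TM,g_S)$ is a smooth vector field, then the field $\tau_{\delta_1,\delta_2}(X)$ of $X$ is given by $$\begin{aligned}\tau_{\delta_1,\delta_2}(X)=&\Big\{-\delta_1\bar\Delta X-\delta_2\bar\Delta\bar\Delta X-\delta_2\sum_{i=1}^m\big[(\nabla_{e_i}R)(e_i,S(X))X+R(e_i,\nabla_{e_i}S(X))X+2R(e_i,S(X))\nabla_{e_i}X\big]\Big\}^v\\&+\Big\{-\delta_1S(X)-\delta_2\bar\Delta S(X)-\delta_2R(X,\bar\Delta X)S(X)+\delta_2\sum_{i=1}^m\big[R(X,\nabla_{e_i}\bar\Delta X)e_i-R(\nabla_{e_i}X,\bar\Delta X)e_i\\&\quad-R(e_i,S(X))e_i-(\nabla_{S(X)}R)(\nabla_{e_i}X,X)e_i+R(X,\nabla_{e_i}X)\nabla_{e_i}S(X)-R(X,R(e_i,S(X))X)e_i\big]\Big\}^h,\end{aligned}$$ where $\{e_i\}_{i=1}^m$ is a local orthonormal frame field of $(M,g)$.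
   Context: Let $\nabla$ be the Levi-Civita connection of $(M,g)$ and $R(X,Y)Z=\nabla_X\nabla_YZ-\nabla_Y\nabla_XZ-\nabla_{[X,Y]}Z$ its curvature. For a vector field $X$ and a local orthonormal frame $\{e_i\}$, $\bar\Delta X=\sum_{i}(\nabla_{\nabla_{e_i}e_i}X-\nabla_{e_i}\nabla_{e_i}X)$ is the rough Laplacian and $S(X)=\sum_iR(\nabla_{e_i}X,X)e_i$. Tangent bundle: in coordinates $(x^i,y^i)$ on $TM$ induced by coordinates $(x^i)$ on $M$, with projection $\pi:TM\to M$, the vertical and horizontal lifts of $Y=Y^i\partial_{x^i}$ are $Y^v=(Y^i\circ\pi)\partial_{y^i}$ and $Y^h=(Y^i\circ\pi)\partial_{x^i}-(\Gamma^i_{jk}\circ\pi)(Y^j\circ\pi)y^k\partial_{y^i}$. The Sasaki metric $g_S$ is determined by $g_S(Y^h,Z^h)=g_S(Y^v,Z^v)=g(Y,Z)\circ\pi$, $g_S(Y^v,Z^h)=0$. A vector field $X$ on $M$ is viewed as the map $x\mapsto(x,X_x)$ from $(M,g)$ to $(TM,g_S)$, and expressions $A^h+B^v$ for sections along this map mean the lifts evaluated at the points $(x,X_x)$. For a smooth map $\varphi:(M,g)\to(N,h)$ of Riemannian manifolds, with pull-back connection $\nabla^\varphi$ on $\varphi^{-1}TN$: the tension field is $\tau(\varphi)=\sum_i\{\nabla^\varphi_{e_i}d\varphi(e_i)-d\varphi(\nabla_{e_i}e_i)\}$; the bitension field is $\tau_2(\varphi)=\Delta^\varphi\tau(\varphi)-\sum_iR^N(\tau(\varphi),d\varphi(e_i))d\varphi(e_i)$,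 where $\Delta^\varphi=-\sum_i(\nabla^\varphi_{e_i}\nabla^\varphi_{e_i}-\nabla^\varphi_{\nabla_{e_i}e_i})$ and $R^N$ is the curvature of $N$ (same sign convention as $R$); and $\tau_{\delta_1,\delta_2}(\varphi)=\delta_1\tau(\varphi)+\delta_2\tau_2(\varphi)$. *)

(* Defs.v *)
From HB Require Import structures.
From mathcomp Require Import all_boot all_order all_algebra.
From mathcomp Require Import all_classical all_reals all_analysis.

Set Implicit Arguments.
Unset Strict Implicit.
Unset Printing Implicit Defensive.

Import Order.TTheory GRing.Theory Num.Theory.
Import numFieldNormedType.Exports.

Local Open Scope classical_set_scope.
Local Open Scope ring_scope.

Section Smooth.
Context {R : realType} {n : nat} {V : normedModType R}.

Definition partial (a : 'I_n) (f : 'rV[R]_n -> V) : 'rV[R]_n -> V :=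
  fun x => 'D_(delta_mx ord0 a) f x.

Fixpoint Ck (k : nat) (D : set 'rV[R]_n) (f : 'rV[R]_n -> V) : Prop :=
  (forall x, D x -> {for x, continuous f}) /\
  if k is k'.+1 then
    forall a : 'I_n,
      (forall x, D x -> derivable f x (delta_mx ord0 a)) /\
      Ck k' D (partial a f)
  else True.

(* Only used for open D. *)
Definition smooth_on (D : set 'rV[R]_n) (f : 'rV[R]_n -> V) : Prop :=
  forall k, Ck k D f.

End Smooth.

(* The bilinear form with Gram matrix A, on row vectors. *)
Definition form {R : realType} {n : nat} (A : 'M[R]_n) (u v : 'rV[R]_n) : R :=
  (u *m A *m v^T) ord0 ord0.

(* A smooth manifold of dimension m: a Hausdorff second countable space with a
   smooth atlas.  The maps chart_map i and chart_inv i are total functions, but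
   are meaningful only on chart_dom i and on its image in R^m respectively. *)
Record manifold (R : realType) (m : nat) := Manifold {
  carrier :> topologicalType;
  chart_index : Type;
  chart_dom : chart_index -> set carrier;
  chart_map : chart_index -> carrier -> 'rV[R]_m;
  chart_inv : chart_index -> 'rV[R]_m -> carrier;
  _ : hausdorff_space carrier;
  _ : @second_countable carrier;
  _ : forall p, exists i, chart_dom i p;
  _ : forall i, open (chart_dom i);
  _ : forall i, open (chart_map i @` chart_dom i);
  _ : forall i p, chart_dom i p -> chart_inv i (chart_map i p) = p;
  _ : forall i p, chart_dom i p -> {for p, continuous (chart_map i)};
  _ : forall i p, chart_dom i p ->
      {for chart_map i p, continuous (chart_inv i)};
  _ : forall i j,
      smooth_on (chart_map i @` (chart_dom i `&` chart_dom j))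
                (fun x => chart_map j (chart_inv i x))
}.

Section Manifold.
Context {R : realType} {m : nat} (M : manifold R m).
Local Notation I := (chart_index M).

Definition transition (i j : I) (x : 'rV[R]_m) : 'rV[R]_m :=
  chart_map j (chart_inv i x).

(* A tangent vector at p is the family of its components in the charts around
   p; the components in the other charts are set to 0 so that a tangent vector
   is determined by its genuine components. *)
Record tangent (p : M) := Tangent {
  comp : I -> 'rV[R]_m;
  _ : forall i j, chart_dom i p -> chart_dom j p ->
      comp j = 'D_(comp i) (transition i j) (chart_map i p);
  _ : forall i, ~ chart_dom i p -> comp i = 0
}.

Definition vfield := forall p : M, tangent p.

(* The components of a vector field in a chart, as functions on R^m. *)
Definition vloc (i : I) (X : vfield) : 'rV[R]_m -> 'rV[R]_m :=
  fun x => comp (X (chart_inv i x)) i.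

Definition smooth_vfield (W : set M) (X : vfield) : Prop :=
  forall i, smooth_on (chart_map i @` (chart_dom i `&` W)) (vloc i X).

(* gram i p is the matrix (g_p(d/dx^a, d/dx^b))_(a, b) in the chart i; its value
   is irrelevant when p is not in chart_dom i. *)
Record metric := Metric {
  gram : I -> M -> 'M[R]_m;
  _ : forall i p, chart_dom i p -> forall u v,
      form (gram i p) u v = form (gram i p) v u;
  _ : forall i p, chart_dom i p -> forall u, u != 0 -> 0 < form (gram i p) u u;
  _ : forall i j p, chart_dom i p -> chart_dom j p -> forall u v,
      form (gram i p) u v =
      form (gram j p) ('D_u (transition i j) (chart_map i p))
                      ('D_v (transition i j) (chart_map i p));
  _ : forall i, smooth_on (chart_map i @` chart_dom i)
                          (fun x => gram i (chart_inv i x))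
}.

Definition gloc (i : I) (g : metric) : 'rV[R]_m -> 'M[R]_m :=
  fun x => gram g i (chart_inv i x).

(* e is a smooth orthonormal frame on the open set W; its values outside W
   are irrelevant. *)
Definition orthonormal_frame (g : metric) (W : set M) (e : 'I_m -> vfield) :=
  (forall a, smooth_vfield W (e a)) /\
  (forall i p, chart_dom i p -> W p -> forall a b,
     form (gram g i p) (comp (e a p) i) (comp (e b p) i) = (a == b)%:R).

Definition tangent_bundle : Type := {p : M & tangent p}.

(* The coordinates (x^i, y^i) on TM induced by the chart i. *)
Definition tchart (i : I) (z : tangent_bundle) : 'rV[R]_(m + m) :=
  row_mx (chart_map i (projT1 z)) (comp (projT2 z) i).

Definition section_map (X : vfield) : M -> tangent_bundle :=
  fun p => existT _ p (X p).

(* The map X : M -> TM read in the chart i and the induced chart on TM. *)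
Definition sloc (i : I) (X : vfield) : 'rV[R]_m -> 'rV[R]_(m + m) :=
  fun x => tchart i (section_map X (chart_inv i x)).

End Manifold.

(* In this section G : 'rV_n -> 'M_n is the Gram matrix of the metric in a chart,
   and vector fields are given by their components 'rV_n -> 'rV_n there. *)

Section Riemannian.
Context {R : realType} {n : nat} (G : 'rV[R]_n -> 'M[R]_n).
Implicit Types (W X Y Z : 'rV[R]_n -> 'rV[R]_n) (x u v w : 'rV[R]_n).

(* Gamma^k_(a b) of the Levi-Civita connection *)
Definition christoffel x (k a b : 'I_n) : R :=
  2^-1 * \sum_l invmx (G x) k l *
    (partial a G x b l + partial b G x a l - partial l G x a b).

Definition Gamma x u v : 'rV[R]_n :=
  \row_k \sum_a \sum_b christoffel x k a b * u ord0 a * v ord0 b.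

Definition nabla Y Z : 'rV[R]_n -> 'rV[R]_n :=
  fun x => 'D_(Y x) Z x + Gamma x (Y x) (Z x).

Definition bracket X Y : 'rV[R]_n -> 'rV[R]_n :=
  fun x => 'D_(X x) Y x - 'D_(Y x) X x.

Definition curv X Y Z : 'rV[R]_n -> 'rV[R]_n :=
  fun x => nabla X (nabla Y Z) x - nabla Y (nabla X Z) x
           - nabla (bracket X Y) Z x.

(* R_x(u, v) w for vectors u, v, w at x, extended with constant components *)
Definition curv_at x u v w : 'rV[R]_n :=
  curv (fun=> u) (fun=> v) (fun=> w) x.

(* (nabla_W R)(X, Y) Z *)
Definition nabla_curv W X Y Z : 'rV[R]_n -> 'rV[R]_n :=
  fun x => nabla W (curv X Y Z) x - curv (nabla W X) Y Z x
           - curv X (nabla W Y) Z x - curv X Y (nabla W Z) x.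

Variable e : 'I_n -> 'rV[R]_n -> 'rV[R]_n.

Definition rough_laplacian X : 'rV[R]_n -> 'rV[R]_n :=
  fun x => \sum_i (nabla (nabla (e i) (e i)) X x
                   - nabla (e i) (nabla (e i) X) x).

Definition S_field X : 'rV[R]_n -> 'rV[R]_n :=
  fun x => \sum_i curv (nabla (e i) X) X (e i) x.

End Riemannian.

(* F is a map read in a chart of the source, with metric G and frame e, and a
   chart of the target, with metric H.  A section along F of the tangent bundle
   of the target is given by its components in the chart of the target. *)

Section Maps.
Context {R : realType} {m n : nat}.
Variables (G : 'rV[R]_m -> 'M[R]_m) (H : 'rV[R]_n -> 'M[R]_n).
Variables (e : 'I_m -> 'rV[R]_m -> 'rV[R]_m) (F : 'rV[R]_m -> 'rV[R]_n).
Implicit Types (Y : 'rV[R]_m -> 'rV[R]_m) (V : 'rV[R]_m -> 'rV[R]_n).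

Definition dmap Y : 'rV[R]_m -> 'rV[R]_n := fun x => 'D_(Y x) F x.

Definition pnabla Y V : 'rV[R]_m -> 'rV[R]_n :=
  fun x => 'D_(Y x) V x + Gamma H (F x) (dmap Y x) (V x).

Definition tension : 'rV[R]_m -> 'rV[R]_n :=
  fun x => \sum_i (pnabla (e i) (dmap (e i)) x - dmap (nabla G (e i) (e i)) x).

Definition pull_laplacian V : 'rV[R]_m -> 'rV[R]_n :=
  fun x => - \sum_i (pnabla (e i) (pnabla (e i) V) x
                     - pnabla (nabla G (e i) (e i)) V x).

Definition bitension : 'rV[R]_m -> 'rV[R]_n :=
  fun x => pull_laplacian tension x
    - \sum_i curv_at H (F x) (tension x) (dmap (e i) x) (dmap (e i) x).

Definition tau_delta (d1 d2 : R) : 'rV[R]_m -> 'rV[R]_n :=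
  fun x => d1 *: tension x + d2 *: bitension x.

End Maps.

(* Points and tangent vectors of TM are written in the induced coordinates
   (x^i, y^i): z = row_mx x y. *)
Section Sasaki.
Context {R : realType} {m : nat} (G : 'rV[R]_m -> 'M[R]_m).
Implicit Types (z : 'rV[R]_(m + m)) (u v : 'rV[R]_m).

Definition vlift z v : 'rV[R]_(m + m) := row_mx 0 v.

Definition hlift z v : 'rV[R]_(m + m) :=
  row_mx v (- Gamma G (lsubmx z) v (rsubmx z)).

(* The rows are the lifts at z, horizontal then vertical, of the coordinate
   vector fields. *)
Definition lift_mx z : 'M[R]_(m + m) :=
  col_mx (\matrix_a hlift z (delta_mx ord0 a))
         (\matrix_a vlift z (delta_mx ord0 a)).

(* The Gram matrix K such that lift_mx z *m K *m (lift_mx z)^T is the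
   block-diagonal matrix (G, G); see sasakiP. *)
Definition sasaki z : 'M[R]_(m + m) :=
  invmx (lift_mx z) *m block_mx (G (lsubmx z)) 0 0 (G (lsubmx z))
    *m (invmx (lift_mx z))^T.

Lemma hliftE z v : hlift z v = row_mx v 0 *m lift_mx z.
Proof.
rewrite /lift_mx mul_row_col mul0mx addr0.
apply/rowP => k; rewrite !mxE; case: splitP => j kj.
  rewrite (bigD1 j) //= big1 ?addr0 => [|a aj].
    rewrite !mxE /=; case: splitP => j' kj'.
      have -> : j' = j by apply/val_inj; rewrite /= -kj -kj'.
      by rewrite mxE !eqxx mulr1.
    by move: (ltn_ord j); rewrite -kj kj' ltnNge leq_addr.
  rewrite !mxE; case: splitP => j' kj'.
    have -> : j' = j by apply/val_inj; rewrite /= -kj -kj'.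
    by rewrite mxE eqxx eq_sym (negPf aj) mulr0.
  by move: (ltn_ord j); rewrite -kj kj' ltnNge leq_addr.
rewrite !mxE -sumrN; apply: eq_bigr => a _; rewrite !mxE.
case: splitP => j' kj'.
  by move: (ltn_ord j'); rewrite -kj' kj ltnNge leq_addr.
have -> : j' = j by apply/val_inj/eqP; rewrite /= -(eqn_add2l m) -kj -kj'.
rewrite !mxE mulrN; congr (- _).
rewrite [in RHS](bigD1 a) //= [X in _ * (_ + X)]big1 ?addr0 => [|c ca].
  rewrite mulr_sumr; apply: eq_bigr => b _.
  by rewrite !mxE !eqxx mulr1 mulrCA mulrA.
by apply: big1 => b _; rewrite !mxE eqxx (negPf ca) mulr0 mul0r.
Qed.

Lemma vliftE z v : vlift z v = row_mx 0 v *m lift_mx z.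
Proof.
rewrite /lift_mx mul_row_col mul0mx add0r.
have -> : \matrix_a vlift z (delta_mx ord0 a) = row_mx 0 1%:M.
  apply/matrixP => a k; rewrite !mxE; case: splitP => j kj; rewrite !mxE //.
  by rewrite eqxx eq_sym.
by rewrite mul_mx_row mulmx0 mulmx1.
Qed.

Lemma lift_mx_unit z : lift_mx z \in unitmx.
Proof.
set B : 'M[R]_m := \matrix_a (- Gamma G (lsubmx z) (delta_mx ord0 a) (rsubmx z)).
have -> : lift_mx z = block_mx 1%:M B 0 1%:M.
  rewrite /lift_mx block_mxEv; congr col_mx.
    apply/matrixP => a k; rewrite !mxE; case: splitP => j kj; rewrite !mxE //.
    by rewrite eqxx eq_sym.
  apply/matrixP => a k; rewrite !mxE; case: splitP => j kj; rewrite !mxE //.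
  by rewrite eqxx eq_sym.
by rewrite unitmxE det_ublock !det1 mulr1 unitr1.
Qed.

Lemma sasakiP z u v :
  [/\ form (sasaki z) (hlift z u) (hlift z v) = form (G (lsubmx z)) u v,
      form (sasaki z) (vlift z u) (vlift z v) = form (G (lsubmx z)) u v &
      form (sasaki z) (vlift z u) (hlift z v) = 0].
Proof.
have E (a b : 'rV[R]_(m + m)) :
    form (sasaki z) (a *m lift_mx z) (b *m lift_mx z) =
    form (block_mx (G (lsubmx z)) 0 0 (G (lsubmx z))) a b.
  rewrite /form /sasaki trmx_mul !mulmxA mulmxK ?lift_mx_unit //.
  rewrite -!mulmxA; congr ((_ *m (_ *m _)) _ _).
  by rewrite mulmxA -trmx_mul mulmxV ?lift_mx_unit // trmx1 mul1mx.
split; rewrite ?hliftE ?vliftE E /form mul_row_block tr_row_mx mul_row_col;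
  by rewrite ?trmx0 ?mulmx0 ?mul0mx ?addr0 ?add0r ?mulmx0 ?mul0mx ?mxE.
Qed.

End Sasaki.

(* Main.v *)
(* Along a map F = (f, y) into TM, a field is written a^h + b^v with a, b along
   f.  The Koszul formula, together with the pair symmetry of the curvature,
   shows that the Levi-Civita connection of the Sasaki metric acts on (a, b) by
     a |-> cov_s a + 1/2 (R(y, b) f_s + R(y, cov_s y) a),
     b |-> cov_s b - 1/2 R(f_s, a) y,
   where cov is the pull-back connection of M along f and f_s the derivative of
   f.  With F the identity of TM, the commutator of these operators yields the
   curvature of the Sasaki metric; with F = X, they yield the tension field
   - S(X)^h - (rough Laplacian of X)^v and, applied twice more, its Laplacian.
   The bitension field then reduces, summand by summand, to an identity which
   only uses the Leibniz rule and the skew-symmetry R(u, v) = - R(v, u). *)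
Require Import Defs.
From HB Require Import structures.
From mathcomp Require Import all_boot all_order all_algebra.
From mathcomp Require Import all_classical all_reals all_analysis.
From mathcomp Require Import ring lra.

Set Implicit Arguments.
Unset Strict Implicit.
Unset Printing Implicit Defensive.

Import Order.TTheory GRing.Theory Num.Theory.
Import numFieldNormedType.Exports.

Local Open Scope classical_set_scope.
Local Open Scope ring_scope.

(** Everything happens in one chart, on the open set where both the chart and the frame are
    available. Fields read in a chart carry no information elsewhere, so almost every rewriting
    comes with a domain condition. Smoothness is given through coordinate partial derivatives,
    whereas the calculus needs derivatives in arbitrary directions that depend linearly on the
    direction and commute; this gap is what the opening analysis fills. The Christoffel symbols of
    the Sasaki metric are not obtained by inverting its Gram matrix of size 2m: they are recognised
    by pairing with an arbitrary vector, the metric being nondegenerate. The factors 1/2 come from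
    the Koszul formula; applying the operators twice produces quarters, which cancel or add up in
    the bitension field between the Laplacian and the curvature of the Sasaki metric. Some halves
    survive for a single index and merge or vanish only after summation over the frame, through
    sum_i R(X, nabla_(e_i) X) e_i = - S(X) and R(S(X), S(X)) = 0. *)

Local Ltac row_ring := apply/rowP => ?; rewrite !mxE; ring.
Local Ltac row_lra := apply/rowP => ?; rewrite !mxE; lra.

(* [form] alone refers to sesquilinear.v. *)
Local Notation form := Defs.form.

(** * Differentiability from continuous partial derivatives *)

Section Differentiability.
Context {R : realType} {V W : normedModType R}.
Implicit Types f g : V -> W.

Lemma differentiableI f (x : V) (df : {linear V -> W}) : continuous df ->
  (forall e, 0 < e ->
     \forall h \near 0, `|f (h + x) - f x - df h| <= e * `|h|) ->
  differentiable f x.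
Proof.
move=> dfc fo.
have E : f \o shift x = cst (f x) + df +o_ 0 id.
  apply/eqaddoP => e e0; have := fo e e0; apply: filterS => h /=.
  by rewrite /cst /= opprD addrA.
apply/diff_locallyP; have dE := diff_unique dfc E.
by split; rewrite dE.
Qed.

Lemma differentiableE f (x : V) : differentiable f x -> forall e, 0 < e ->
  \forall h \near 0, `|f (h + x) - f x - 'd f x h| <= e * `|h|.
Proof.
move=> /diff_locallyP[_ /eqaddoP fo] e e0; have := fo e e0.
by apply: filterS => h /=; rewrite /cst /= opprD addrA.
Qed.

Lemma differentiable_near_eq f g (x : V) :
  (\near x, f x = g x) -> differentiable f x -> differentiable g x.
Proof.
move=> fg df; apply: (@differentiableI g x ('d f x)).
  by have [] := (diff_locallyP _ _).1 df.
move=> e e0; have fg0 : \forall h \near 0, f (h + x) = g (h + x).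
  by move: fg; rewrite [in X in X -> _](near_shift 0) subr0.
apply: filterS2 fg0 (differentiableE df e0) => h <-.
by rewrite -(nbhs_singleton fg).
Qed.

Lemma derive_line f (u v : V) (s : R) :
  'D_1 (fun t : R => f (t *: v + u)) s = 'D_v f (s *: v + u).
Proof.
rewrite /derive; set g1 := fun h => h^-1 *: _; set g2 := fun h => h^-1 *: _.
suff -> : g1 = g2 by [].
by apply/funext => h; rewrite /g1 /g2 /= [h%:A]mulr1 scalerDl addrA.
Qed.

Lemma derivable_line f (u v : V) (s : R) :
  derivable f (s *: v + u) v ->
  derivable (fun t : R => f (t *: v + u)) s 1.
Proof.
rewrite /derivable; set g1 := fun h => h^-1 *: _; set g2 := fun h => h^-1 *: _.
suff -> : g1 = g2 by [].
by apply/funext => h; rewrite /g1 /g2 /= [h%:A]mulr1 scalerDl addrA.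
Qed.

End Differentiability.

Section MeanValue.
Context {R : realType} {V : normedModType R}.
Implicit Types f : V -> R.

(** The increment [c] may have either sign, so the one-variable theorem is applied on the segment
    from 0 to [c] or from [c] to 0; the bound on [|s|] covers both cases. *)
Lemma mean_value_line f (x v : V) (c : R) :
  (forall s, `|s| <= `|c| -> derivable f (s *: v + x) v) ->
  exists2 s, `|s| <= `|c| & f (c *: v + x) - f x = c * 'D_v f (s *: v + x).
Proof.
move=> df; pose g (t : R) := f (t *: v + x).
pose dg' s := 'D_v f (s *: v + x).
have dg s : `|s| <= `|c| -> is_derive s (1 : R) g (dg' s).
  move=> sc; split; first exact/derivable_line/df.
  exact: derive_line.
have cg (a b : R) : (forall s, s \in `[a, b] -> `|s| <= `|c|) ->
    {within `[a, b], continuous g}.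
  move=> ab; apply: derivable_within_continuous => s /ab sc.
  by have [] := dg s sc.
have g0 : g 0 = f x by rewrite /g scale0r add0r.
have [c0|/ltW c0] := leP 0 c.
  have in0c s : s \in `[0, c] -> `|s| <= `|c|.
    by rewrite in_itv /= => /andP[s0 sc]; rewrite !ger0_norm.
  have [|s s0c E] := @MVT_segment _ g dg' 0 c c0 _ (cg _ _ in0c).
    by move=> s s0c; apply: dg; apply: in0c; exact: subset_itv_oo_cc.
  exists s; first exact: in0c.
  by rewrite -g0 -/(g c) E subr0 mulrC.
have inc0 s : s \in `[c, 0] -> `|s| <= `|c|.
  by rewrite in_itv /= => /andP[s0 sc]; rewrite !ler0_norm // lerN2.
have [|s s0c E] := @MVT_segment _ g dg' c 0 c0 _ (cg _ _ inc0).
  by move=> s s0c; apply: dg; apply: inc0; exact: subset_itv_oo_cc.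
exists s; first exact: inc0.
by rewrite -g0 -/(g c) -[g c - g 0]opprB E sub0r mulrN opprK mulrC.
Qed.

End MeanValue.

Lemma normr_entry (R : realType) m n (A : 'M[R]_(m, n)) i j :
  `|A i j| <= `|A|.
Proof.
rewrite [leRHS]/Num.Def.normr /= mx_normrE.
exact: (le_bigmax _ (fun ij : 'I_m * 'I_n => `|A ij.1 ij.2|) (i, j)).
Qed.

Lemma mx_norm_le (R : realType) m n (A : 'M[R]_(m, n)) c : 0 <= c ->
  (forall i j, `|A i j| <= c) -> `|A| <= c.
Proof.
move=> c0 Ac; rewrite [leLHS]/Num.Def.normr /= mx_normrE.
by apply: bigmax_le => // -[i j] _; exact: Ac.
Qed.

Section ContinuousPartials.
Context {R : realType} {n : nat}.
Implicit Types f : 'rV[R]_n -> R.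

(* Telescoping over the coordinates: h is built up one coordinate at a time,
   and the mean value theorem is applied along each edge of this path. *)
Lemma differentiable_partial f (x : 'rV[R]_n) (r : R) : 0 < r ->
  (forall a y, ball x r y -> derivable f y (delta_mx ord0 a)) ->
  (forall a, {for x, continuous (partial a f)}) ->
  differentiable f x.
Proof.
move=> r0 df cf.
pose L (h : 'rV[R]_n) := \sum_a h ord0 a * partial a f x.
have Llin : linear L.
  move=> c u v; rewrite /L scaler_sumr -big_split /=; apply: eq_bigr => a _.
  by rewrite !mxE mulrDl -mulrA.
pose LM := GRing.isLinear.Build _ _ _ _ _ Llin.
pose LL : {linear 'rV[R]_n -> R} := HB.pack L LM.
apply: (@differentiableI _ _ _ f x LL).
  move=> h; rewrite /LL /= /L.
  have -> : (fun h : 'rV[R]_n => \sum_a h ord0 a * partial a f x) =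
            (\sum_a (fun h : 'rV[R]_n => h ord0 a * partial a f x)).
    by apply/funext => k; rewrite fct_sumE.
  apply: differentiable_continuous; apply: differentiable_sum => a.
  by apply: differentiableM => //; exact: differentiable_coord.
(* Each of the n edges will cost at most [e' * |h|]; dividing by n + 1 rather than n keeps this
   meaningful for n = 0. *)
move=> e e0; pose e' := e / n.+1%:R.
have e'0 : 0 < e' by rewrite divr_gt0.
have : \forall y \near x, ball x r y /\
    forall a, `|partial a f y - partial a f x| <= e'.
  near=> y; split; first by near: y; exact: nbhsx_ballx x r r0.
  move=> a; rewrite distrC; move: a; near: y; apply: filter_forall => a.
  have cfa : partial a f @ nbhs x --> partial a f x by exact: (cf a).
  by have := (cvgrPdist_le _ _).1 cfa e' e'0; exact.
rewrite (near_shift 0) /= => /nbhs_ballP[d /= d0 dP].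
apply/nbhs_ballP; exists d => // h; rewrite /= -ball_normE /= sub0r normrN => hd.
have {}dP y : `|y| <= `|h| -> ball x r (y + x) /\
    forall a, `|partial a f (y + x) - partial a f x| <= e'.
  move=> yh; have := dP y; rewrite /= subr0; apply.
  by rewrite -ball_normE /= sub0r normrN (le_lt_trans yh).
pose hk k : 'rV[R]_n := \row_a (if (a < k)%N then h ord0 a else 0).
have key k : (k <= n)%N -> `|f (hk k + x) - f x - L (hk k)| <= k%:R * (e' * `|h|).
  elim: k => [_|k IH kn].
    have -> : hk 0%N = 0 by apply/rowP => a; rewrite !mxE.
    rewrite add0r subrr sub0r normrN mul0r.
    by rewrite /L big1 ?normr0 // => a _; rewrite mxE mul0r.
  pose a := Ordinal kn; pose ea : 'rV[R]_n := delta_mx ord0 a.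
  have hkS : hk k.+1 = h ord0 a *: ea + hk k.
    apply/rowP => b; rewrite !mxE eqxx /= ltnS leq_eqVlt -val_eqE /=.
    have [bk|bk] := eqVneq (b : nat) k; last by rewrite mulr0 add0r.
    have -> : b = a by apply/val_inj.
    by rewrite mulr1 /= ltnn addr0.
  (* The norm of a row vector is the largest absolute value of its entries, so truncating [h] and
     shortening one coordinate stays within [|h|], hence inside the ball where the partial
     derivatives are controlled. *)
  have small s : `|s| <= `|h ord0 a| -> `|s *: ea + hk k| <= `|h|.
    move=> sh; apply: mx_norm_le => // i b; rewrite ord1 !mxE eqxx /=.
    have [->|ba] := eqVneq b a.
      rewrite mulr1 /= ltnn addr0; apply: le_trans sh _; exact: normr_entry.
    rewrite mulr0 add0r; case: ifP => _; last by rewrite normr0.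
    exact: normr_entry.
  have [s sh E] : exists2 s, `|s| <= `|h ord0 a| &
      f (h ord0 a *: ea + (hk k + x)) - f (hk k + x) =
      h ord0 a * 'D_ea f (s *: ea + (hk k + x)).
    apply: mean_value_line => s sh; apply: df; rewrite addrA.
    by have [] := dP _ (small s sh).
  have LS : L (hk k.+1) = h ord0 a * partial a f x + L (hk k).
    rewrite hkS -[L _]/(LL _) linearP /=; congr (_ * _ + _).
    rewrite /L (bigD1 a) //= big1 ?addr0 => [|b ba].
      by rewrite mxE !eqxx mul1r.
    by rewrite mxE eqxx (negPf ba) mul0r.
  have -> : f (hk k.+1 + x) - f x - L (hk k.+1) =
      h ord0 a * ('D_ea f (s *: ea + (hk k + x)) - partial a f x) +
      (f (hk k + x) - f x - L (hk k)).
    by rewrite LS hkS -(addrA _ (hk k) x) mulrBr -E; ring.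
  rewrite -natr1 mulrDl mul1r [leRHS]addrC.
  apply: le_trans (ler_normD _ _) (lerD _ (IH (ltnW kn))).
  rewrite normrM mulrC; apply: ler_pM => //; last exact: normr_entry.
  by have [_ /(_ a)] := dP _ (small s sh); rewrite addrA.
have hn : hk n = h by apply/rowP => a; rewrite mxE ltn_ord.
have := key n (leqnn n); rewrite hn => /le_trans; apply.
rewrite mulrA ler_wpM2r // /e' mulrCA ler_piMr ?(ltW e0) //.
by rewrite ler_pdivrMr ?ltr0n // mul1r ler_nat.
Unshelve. all: by end_near. Qed.

End ContinuousPartials.

(** * Product and chain rules for directional derivatives *)

Section ScaleProduct.
Context {R : realType} {U V : normedModType R}.
Implicit Types (f : U -> R) (g : U -> V).

Lemma scale_is_bilinear :
  bilinear_for
    (GRing.Scale.Law.clone _ _ *:%R _) (GRing.Scale.Law.clone _ _ *:%R _)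
    (@GRing.scale R V).
Proof.
split=> [v|a] b x y /=.
- by rewrite scalerDl scalerA.
- by rewrite scalerDr !scalerA mulrC.
Qed.

HB.instance Definition _ :=
  bilinear_isBilinear.Build R R V V _ _ (@GRing.scale R V) scale_is_bilinear.

Lemma is_diff_scale_fun f g x : differentiable f x -> differentiable g x ->
  is_diff x (fun y => f y *: g y) (fun v => f x *: 'd g x v + 'd f x v *: g x).
Proof.
move=> df dg.
have c : continuous (fun p : R * V => p.1 *: p.2) by exact: scale_continuous.
have -> : (fun y => f y *: g y) =
    (fun p : R * V => p.1 *: p.2) \o (fun y => (f y, g y)) by [].
have dfg : differentiable (fun y => (f y, g y)) x by exact: differentiable_pair.
have db p : differentiable (fun p : R * V => p.1 *: p.2) p.
  exact: (@differentiable_bilin R R V V (@GRing.scale R V) p c).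
apply: DiffDef; first exact: differentiable_comp.
rewrite diff_comp //.
rewrite (@diff_bilin R R V V (@GRing.scale R V) _ c) diff_pair //.
Qed.

Lemma derive_scale_fun f g x v : differentiable f x -> differentiable g x ->
  'D_v (fun y => f y *: g y) x = f x *: 'D_v g x + 'D_v f x *: g x.
Proof.
move=> df dg; have [dfg E] := is_diff_scale_fun df dg.
by rewrite !deriveE // E.
Qed.

End ScaleProduct.

Section DeriveComposition.
Context {R : realType} {U V W : normedModType R}.

Lemma derive_comp_linear (l : {linear V -> W}) (f : U -> V) x v :
  continuous l -> differentiable f x -> 'D_v (l \o f) x = l ('D_v f x).
Proof.
move=> lc df; have dl := linear_differentiable (f x) lc.
rewrite deriveE; last exact: differentiable_comp.
by rewrite diff_comp //= diff_lin // deriveE.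
Qed.

Lemma derive_comp (f : U -> V) (g : V -> W) x v :
  differentiable f x -> differentiable g (f x) ->
  'D_v (g \o f) x = 'D_('D_v f x) g (f x).
Proof.
move=> df dg; rewrite deriveE; last exact: differentiable_comp.
by rewrite diff_comp //= !deriveE.
Qed.

End DeriveComposition.

(** * Smooth maps *)

Section Smooth.
Context {R : realType} {U : normedModType R}.
Implicit Types (D : set U).

Fixpoint times_diff {V : normedModType R} (k : nat) D (f : U -> V) : Prop :=
  if k is k'.+1 then
    (forall x, D x -> differentiable f x) /\ forall v, times_diff k' D ('D_v f)
  else True.

(* Differentiability along all constant directions, and not only along the
   coordinate ones, to all orders. *)
Definition smooth {V : normedModType R} D (f : U -> V) : Prop :=
  forall k, times_diff k D f.

Context {V : normedModType R} (D : set U) (Dop : open D).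
Implicit Types f g : U -> V.

Lemma near_open x : D x -> \forall y \near x, D y.
Proof. by move=> Dx; apply: open_nbhs_nbhs. Qed.

Lemma derive_eq_open f g x v : (forall y, D y -> f y = g y) -> D x ->
  'D_v f x = 'D_v g x.
Proof.
move=> fg Dx; apply: near_eq_derive.
by apply: filterS (near_open Dx) => y; exact: fg.
Qed.

Lemma differentiable_eq_open f g x : (forall y, D y -> f y = g y) -> D x ->
  differentiable f x -> differentiable g x.
Proof.
move=> fg Dx; apply: differentiable_near_eq.
by apply: filterS (near_open Dx) => y; exact: fg.
Qed.

(** Only values on the open set matter. The closure properties below prove a formula for the
    derivative that is valid on [D] and transport smoothness along it by this lemma. *)
Lemma times_diff_eq k f g : (forall y, D y -> f y = g y) ->
  times_diff k D f -> times_diff k D g.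
Proof.
elim: k f g => //= k IH f g fg [df Df]; split=> [x Dx|v].
  exact: differentiable_eq_open fg Dx (df x Dx).
by apply: IH (Df v) => y Dy; exact: derive_eq_open.
Qed.

Lemma smooth_eq f g : (forall y, D y -> f y = g y) -> smooth D f -> smooth D g.
Proof. by move=> fg sf k; apply: times_diff_eq (sf k). Qed.

Lemma times_diffW k f : times_diff k.+1 D f -> times_diff k D f.
Proof.
elim: k f => // k IH f [df Df]; split=> // v; exact: IH.
Qed.

Lemma smooth_differentiable f x : smooth D f -> D x -> differentiable f x.
Proof. by move=> /(_ 1%N)[df _] /df. Qed.

Lemma smooth_derive f v : smooth D f -> smooth D ('D_v f).
Proof. by move=> sf k; have [_] := sf k.+1; apply. Qed.

Lemma times_diff_cst k (c : V) : times_diff k D (fun=> c).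
Proof.
elim: k c => //= k IH c; split=> [x _|v]; first exact: differentiable_cst.
have -> : 'D_v (fun=> c) = (fun=> 0 : V)
    :> (U -> V) by apply/funext => x; exact: derive_cst.
exact: IH.
Qed.

Lemma smooth_cst (c : V) : smooth D (fun=> c).
Proof. by move=> k; exact: times_diff_cst. Qed.

Lemma times_diffD k f g : times_diff k D f -> times_diff k D g ->
  times_diff k D (fun x => f x + g x).
Proof.
elim: k f g => //= k IH f g [df Df] [dg Dg]; split=> [x Dx|v].
  exact: differentiableD (df x Dx) (dg x Dx).
apply: times_diff_eq (IH _ _ (Df v) (Dg v)) => y Dy.
by rewrite -deriveD //; apply: diff_derivable; [exact: df|exact: dg].
Qed.

Lemma smoothD f g : smooth D f -> smooth D g -> smooth D (fun x => f x + g x).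
Proof. by move=> sf sg k; exact: times_diffD. Qed.

End Smooth.

Section SmoothModule.
Context {R : realType} {U V : normedModType R} (D : set U) (Dop : open D).
Implicit Types f g : U -> V.

Lemma times_diffM k (f : U -> R) g : times_diff k D f -> times_diff k D g ->
  times_diff k D (fun x => f x *: g x).
Proof.
elim: k f g => //= k IH f g [df Df] [dg Dg]; split=> [x Dx|v].
  by have [] := is_diff_scale_fun (df x Dx) (dg x Dx).
have sf : times_diff k D f by exact: times_diffW (conj df Df).
have sg : times_diff k D g by exact: (times_diffW (conj dg Dg)).
apply: (times_diff_eq Dop _)
  (times_diffD Dop (IH _ _ sf (Dg v)) (IH _ _ (Df v) sg)) => y Dy.
by rewrite derive_scale_fun //; [exact: df|exact: dg].
Qed.

Lemma smoothM (f : U -> R) g : smooth D f -> smooth D g ->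
  smooth D (fun x => f x *: g x).
Proof. by move=> sf sg k; exact: times_diffM. Qed.

Lemma smoothZ c f : smooth D f -> smooth D (fun x => c *: f x).
Proof. by move=> sf; apply: smoothM => //; exact: smooth_cst. Qed.

Lemma smoothN f : smooth D f -> smooth D (fun x => - f x).
Proof.
by move=> sf; apply: (smooth_eq Dop _) (smoothZ (-1) sf) => y _; rewrite scaleN1r.
Qed.

Lemma smoothB f g : smooth D f -> smooth D g -> smooth D (fun x => f x - g x).
Proof. by move=> sf sg; apply: (smoothD Dop) => //; exact: smoothN. Qed.

Lemma times_diff_sum k (I : Type) (s : seq I) (P : pred I) (F : I -> U -> V) :
  (forall i, times_diff k D (F i)) ->
  times_diff k D (fun x => \sum_(i <- s | P i) F i x).
Proof.
move=> sF; elim: s => [|i s IH].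
  apply: (times_diff_eq Dop _) (times_diff_cst D k (0 : V)) => y _.
  by rewrite big_nil.
have [Pi|Pi] := boolP (P i).
  apply: (times_diff_eq Dop _) (times_diffD Dop (sF i) IH) => y _.
  by rewrite big_cons Pi.
by apply: (times_diff_eq Dop _) IH => y _; rewrite big_cons (negPf Pi).
Qed.

Lemma smooth_sum (I : Type) (s : seq I) (P : pred I) (F : I -> U -> V) :
  (forall i, smooth D (F i)) -> smooth D (fun x => \sum_(i <- s | P i) F i x).
Proof. by move=> sF k; apply: times_diff_sum => i; exact: sF. Qed.

End SmoothModule.

Section SmoothComposition.
Context {R : realType} {U V W : normedModType R}.

Lemma smooth_comp_linear (D : set U) (l : {linear V -> W}) (f : U -> V) :
  open D -> continuous l -> smooth D f -> smooth D (fun x => l (f x)).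
Proof.
move=> Dop lc sf k; elim: k f sf => //= k IH f sf; split=> [x Dx|v].
  have df := smooth_differentiable sf Dx.
  by apply: (differentiable_comp df); exact: linear_differentiable.
apply: (times_diff_eq Dop _) (IH _ (smooth_derive v sf)) => x Dx.
by rewrite -derive_comp_linear //; exact: smooth_differentiable Dx.
Qed.

Lemma smooth_linear (D : set U) (l : {linear U -> V}) :
  continuous l -> smooth D l.
Proof.
move=> lc [|k] //=; split=> [x _|v]; first exact: linear_differentiable.
have -> : 'D_v l = (fun=> l v).
  apply/funext => x; rewrite deriveE ?diff_lin //.
  exact: linear_differentiable.
exact: times_diff_cst.
Qed.

Lemma derive_linear (l : {linear U -> V}) x v : continuous l -> 'D_v l x = l v.
Proof.
by move=> lc; rewrite deriveE ?diff_lin //; exact: linear_differentiable.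
Qed.

End SmoothComposition.

Section SmoothReal.
Context {R : realType} {U : normedModType R} (D : set U) (Dop : open D).
Implicit Types f g : U -> R.

Lemma smoothMr f g : smooth D f -> smooth D g -> smooth D (fun x => f x * g x).
Proof. exact: (smoothM Dop). Qed.

Lemma smooth_prod (I : Type) (s : seq I) (P : pred I) (F : I -> U -> R) :
  (forall i, smooth D (F i)) -> smooth D (fun x => \prod_(i <- s | P i) F i x).
Proof.
move=> sF; elim: s => [|i s IH].
  by apply: (smooth_eq Dop _) (smooth_cst D (1 : R)) => y _; rewrite big_nil.
have [Pi|Pi] := boolP (P i).
  by apply: (smooth_eq Dop _) (smoothMr (sF i) IH) => y _; rewrite big_cons Pi.
by apply: (smooth_eq Dop _) IH => y _; rewrite big_cons (negPf Pi).
Qed.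

Lemma smoothV f : (forall x, D x -> f x != 0) -> smooth D f ->
  smooth D (fun x => (f x)^-1).
Proof.
move=> f0 sf; elim => //= k IH; split=> [x Dx|v].
  by apply: differentiableV; [exact: smooth_differentiable Dx|exact: f0].
(* The derivative of 1/f is built from f' and two factors 1/f, so order k for 1/f gives order k +
   1. *)
have H : times_diff k D (fun x => (- (f x)^-1 * (f x)^-1) *: 'D_v f x).
  apply: (times_diffM Dop) => //; last exact: smooth_derive.
  apply: (times_diffM Dop) => //.
  apply: (times_diff_eq Dop (f := fun x => (-1) *: (f x)^-1)) => // [y _|].
    by rewrite scaleN1r.
  by apply: (times_diffM Dop) => //; exact: times_diff_cst.
apply: (times_diff_eq Dop _) H => y Dy.
rewrite deriveV; [|exact: f0|]; last first.
  by apply: diff_derivable; exact: smooth_differentiable Dy.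
by rewrite -exprVn expr2 mulNr.
Qed.

End SmoothReal.

Section SmoothMatrix.
Context {R : realType} {U : normedModType R} {p q : nat}.
Implicit Types (F : U -> 'M[R]_(p, q)) (D : set U).

Lemma differentiable_mx F x :
  (forall i j, differentiable (fun y => F y i j) x) -> differentiable F x.
Proof.
move=> dF.
have -> : F = \sum_(i < p) \sum_(j < q) (fun y => F y i j *: delta_mx i j).
  apply/funext => y; rewrite fct_sumE [LHS]matrix_sum_delta.
  by apply: eq_bigr => i _; rewrite fct_sumE.
apply: differentiable_sum => i; apply: differentiable_sum => j.
exact: (differentiableZl _ (dF i j)).
Qed.

Lemma differentiable_entry F x i j :
  differentiable F x -> differentiable (fun y => F y i j) x.
Proof.
move=> dF; exact: (differentiable_comp dF (differentiable_coord _ i j)).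
Qed.

Lemma derive_entry F x v i j : differentiable F x ->
  'D_v F x i j = 'D_v (fun y => F y i j) x.
Proof.
by move=> dF; rewrite (derive_mx (diff_derivable dF)) mxE.
Qed.

Lemma smooth_entry D F i j : open D ->
  smooth D F -> smooth D (fun x => F x i j).
Proof.
move=> Dop sF k; elim: k F sF => //= k IH F sF; split=> [x Dx|v].
  by apply: differentiable_entry; exact: smooth_differentiable Dx.
apply: (times_diff_eq Dop _) (IH _ (smooth_derive v sF)) => x Dx.
by rewrite derive_entry //; exact: smooth_differentiable Dx.
Qed.

Lemma smooth_mx D F : open D ->
  (forall i j, smooth D (fun x => F x i j)) -> smooth D F.
Proof.
move=> Dop sF.
have H : smooth D (fun x => \sum_(i < p) \sum_(j < q) F x i j *: delta_mx i j).
  apply: (smooth_sum Dop) => i; apply: (smooth_sum Dop) => j.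
  by apply: (smoothM Dop) => //; exact: smooth_cst.
by apply: (smooth_eq Dop) H => x _; rewrite -matrix_sum_delta.
Qed.

End SmoothMatrix.

Section SmoothOn.
Context {R : realType} {n p q : nat} (D : set 'rV[R]_n) (Dop : open D).
Implicit Types f : 'rV[R]_n -> 'M[R]_(p, q).

Lemma smooth_on_partial f a : smooth_on D f -> smooth_on D (partial a f).
Proof. by move=> sf k; have [_ /(_ a)[]] := sf k.+1. Qed.

(** The mean value criterion concerns real functions and is applied entrywise. Its continuity
    hypothesis is inherited from the matrix-valued partial derivative, whose entries agree with the
    partial derivatives of the entries near [x]. *)
Lemma smooth_on_differentiable f x : smooth_on D f -> D x -> differentiable f x.
Proof.
move=> sf Dx; apply: differentiable_mx => i j.
have df a y : D y -> derivable f y (delta_mx ord0 a).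
  by move=> Dy; have [_ /(_ a)[/(_ y Dy)]] := sf 1%N.
have [r /= r0 rD] : nbhs_ball x D by apply/nbhs_ballP; exact: (near_open Dop Dx).
apply: (differentiable_partial r0) => [a y /rD Dy|a].
  exact: (derivable_mxP _ _ _).1 (df a y Dy) i j.
have cf : {for x, continuous (partial a f)}.
  by have [/(_ x Dx)] := smooth_on_partial a sf 0%N.
have cfij : {for x, continuous (fun y => partial a f y i j)}.
  apply: (@continuous_comp _ _ _ (partial a f) (fun A : 'M[R]_(p, q) => A i j)).
    exact: cf.
  exact: coord_continuous.
have E y : D y -> partial a (fun y => f y i j) y = partial a f y i j.
  by move=> Dy; rewrite /partial (derive_mx (df a y Dy)) mxE.
have : \forall y \near x, partial a f y i j = partial a (fun y => f y i j) y.
  by apply: filterS (near_open Dop Dx) => y /E.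
rewrite /prop_for /continuous_at E // => /near_eq_cvg Ec.
exact: cvg_trans Ec cfij.
Qed.

Lemma derive_partial f x v : differentiable f x ->
  'D_v f x = \sum_a v ord0 a *: partial a f x.
Proof.
move=> df; rewrite deriveE // [in LHS](row_sum_delta v) linear_sum.
by apply: eq_bigr => a _; rewrite linearZ /partial deriveE.
Qed.

(** Once [f] is differentiable, its derivative along any fixed [v] is a combination of partial
    derivatives with constant coefficients, to which the induction applies. *)
Lemma smooth_on_smooth f : smooth_on D f -> smooth D f.
Proof.
move=> sf k; elim: k f sf => //= k IH f sf; split=> [x Dx|v].
  exact: smooth_on_differentiable.
have H : times_diff k D (fun x => \sum_a v ord0 a *: partial a f x).
  apply: (times_diff_sum Dop) => a; apply: (times_diffM Dop).
    exact: times_diff_cst.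
  by apply: IH; exact: smooth_on_partial.
apply: (times_diff_eq Dop) H => x Dx.
by rewrite -derive_partial //; exact: smooth_on_differentiable.
Qed.

End SmoothOn.

Section LinearArgument.
Context {R : realType} {U V : normedModType R} {n : nat}.
Variables (D : set U) (Dop : open D).
Variables (L : U -> 'rV[R]_n -> V) (A : U -> 'rV[R]_n).
Hypothesis Llin : forall x, D x -> linear (L x).

Let L_sum x u : D x -> L x u = \sum_a u ord0 a *: L x (delta_mx ord0 a).
Proof.
move=> Dx; pose LM := GRing.isLinear.Build _ _ _ _ _ (Llin Dx).
pose LL : {linear 'rV[R]_n -> V} := HB.pack (L x) LM.
rewrite -[L x]/(LL : _ -> _) [in LHS](row_sum_delta u) linear_sum.
by apply: eq_bigr => a _; rewrite linearZ.
Qed.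

(** Expanding [A x] in the standard basis leaves only [L] at fixed vectors, so separate smoothness
    in [x] suffices. The Christoffel map, the metric and the curvature are all treated slot by slot
    in this way. *)
Lemma smooth_linear_arg : (forall u, smooth D (L ^~ u)) -> smooth D A ->
  smooth D (fun x => L x (A x)).
Proof.
move=> sL sA.
have H : smooth D (fun x => \sum_a A x ord0 a *: L x (delta_mx ord0 a)).
  apply: (smooth_sum Dop) => a; apply: (smoothM Dop); last exact: sL.
  exact: smooth_entry.
by apply: (smooth_eq Dop) H => x Dx; rewrite -L_sum.
Qed.

Variable x : U.
Hypothesis Dx : D x.
Hypothesis dL : forall u, differentiable (L ^~ u) x.
Hypothesis dA : differentiable A x.

Lemma derive_linear_arg w :
  'D_w (fun y => L y (A y)) x = 'D_w (L ^~ (A x)) x + L x ('D_w A x).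
Proof.
have dM a : differentiable (fun y => A y ord0 a *: L y (delta_mx ord0 a)) x.
  by have [] := is_diff_scale_fun (differentiable_entry ord0 a dA) (dL (delta_mx ord0 a)).
have E : 'D_w (fun y => L y (A y)) x =
    'D_w (\sum_a (fun y => A y ord0 a *: L y (delta_mx ord0 a))) x.
  by apply: (derive_eq_open Dop) => // y Dy; rewrite [LHS]L_sum // fct_sumE.
have E' : 'D_w (L ^~ (A x)) x =
    'D_w (\sum_a (fun y => A x ord0 a *: L y (delta_mx ord0 a))) x.
  by apply: (derive_eq_open Dop) => // y Dy; rewrite [LHS]L_sum // fct_sumE.
rewrite E E' derive_sum; last by move=> a; exact: diff_derivable.
rewrite derive_sum; last first.
  move=> a; apply: derivableZ; exact: diff_derivable.
rewrite [L x _]L_sum // -big_split /=; apply: eq_bigr => a _.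
rewrite derive_scale_fun //; last exact: differentiable_entry.
rewrite derive_entry //; congr (_ + _).
by rewrite -deriveZ //; exact: diff_derivable.
Qed.

End LinearArgument.

(** * Symmetry of second derivatives *)

Section Schwarz.
Context {R : realType} {V : normedModType R} (D : set V) (Dop : open D).
Implicit Types (f : V -> R) (x u v : V).

Lemma derive_shift_arg f c x u : 'D_u (fun y => f (c + y)) x = 'D_u f (c + x).
Proof.
rewrite /derive; set g1 := fun h => h^-1 *: _; set g2 := fun h => h^-1 *: _.
by suff -> : g1 = g2 by []; apply/funext => h; rewrite /g1 /g2 /= addrCA.
Qed.

Lemma derivable_shift_arg f c x u :
  derivable f (c + x) u -> derivable (fun y => f (c + y)) x u.
Proof.
rewrite /derivable; set g1 := fun h => h^-1 *: _; set g2 := fun h => h^-1 *: _.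
by suff -> : g1 = g2 by []; apply/funext => h; rewrite /g1 /g2 /= addrCA.
Qed.

(** The mean value theorem is used twice: along [u] for the increment [g] of [f] by [t *: v], then
    along [v] for the derivative of [f] along [u]. *)
Lemma second_difference f x u v (t : R) : smooth D f ->
  (forall s s', `|s| <= `|t| -> `|s'| <= `|t| -> D (s *: u + s' *: v + x)) ->
  exists s s', [/\ `|s| <= `|t|, `|s'| <= `|t| &
    f (t *: v + (t *: u + x)) - f (t *: u + x) - (f (t *: v + x) - f x) =
    t * (t * 'D_v ('D_u f) (s *: u + s' *: v + x))].
Proof.
move=> sf sD; pose g y := f (t *: v + y) - f y.
have df y w : D y -> derivable f y w.
  by move=> Dy; apply: diff_derivable; exact: smooth_differentiable Dy.
have D1 s : `|s| <= `|t| -> D (t *: v + (s *: u + x)).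
  by move=> st; rewrite addrCA addrA; exact: sD.
have D2 s : `|s| <= `|t| -> D (s *: u + x).
  by move=> st; have := sD s 0 st; rewrite normr0 scale0r addr0; exact.
have [s st E] : exists2 s, `|s| <= `|t| & g (t *: u + x) - g x = t * 'D_u g (s *: u + x).
  apply: mean_value_line => s st; apply: derivableB.
    by apply: derivable_shift_arg; apply: df; exact: D1.
  by apply: df; exact: D2.
have [s' s't E'] : exists2 s', `|s'| <= `|t| &
    'D_u f (t *: v + (s *: u + x)) - 'D_u f (s *: u + x) =
    t * 'D_v ('D_u f) (s' *: v + (s *: u + x)).
  apply: (@mean_value_line _ _ ('D_u f)) => s' s't; apply: diff_derivable.
  apply: (smooth_differentiable (smooth_derive u sf)).
  by rewrite addrCA addrA; exact: sD.
exists s, s'; split => //; rewrite -/(g (t *: u + x)) -/(g x) E.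
rewrite deriveB; [|by apply: derivable_shift_arg; apply: df; exact: D1|]; last first.
  by apply: df; exact: D2.
by rewrite derive_shift_arg E' addrCA addrA.
Qed.

(** The second difference of [f] is symmetric in [u] and [v]. Computed in both orders, it shows that
    the two mixed derivatives take a common value at points close to [x]; both being continuous,
    they differ at [x] by less than any [e]. *)
Lemma derive_comm f x u v : smooth D f -> D x ->
  'D_u ('D_v f) x = 'D_v ('D_u f) x.
Proof.
move=> sf Dx; apply/eqP; rewrite -subr_eq0 -normr_eq0; apply/eqP.
apply/eqP; rewrite eq_le normr_ge0 andbT; apply/ler_addgt0Pl => e e0; rewrite addr0.
have e20 : 0 < e / 2 by rewrite divr_gt0.
have cP w w' : \forall y \near x, `|'D_w ('D_w' f) x - 'D_w ('D_w' f) y| <= e / 2.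
  have c : 'D_w ('D_w' f) @ nbhs x --> 'D_w ('D_w' f) x.
    have dd := smooth_differentiable (smooth_derive w (smooth_derive w' sf)) Dx.
    exact: (differentiable_continuous dd).
  by have := (cvgrPdist_le _ _).1 c _ e20; exact.
have : \forall y \near x, [/\ D y,
    `|'D_u ('D_v f) x - 'D_u ('D_v f) y| <= e / 2 &
    `|'D_v ('D_u f) x - 'D_v ('D_u f) y| <= e / 2].
  by apply: filterS3 (near_open Dop Dx) (cP u v) (cP v u) => y.
move=> /nbhs_ballP[r /= r0 rP].
(* Chosen so that [t * (|u| + |v|)] stays below [r]: the added 1 avoids a division by zero when both
   vectors vanish, and halving [r] makes the bound strict. *)
pose t := r / 2 / (`|u| + `|v| + 1).
have n0 : 0 < `|u| + `|v| + 1 by rewrite ltr_wpDl // addr_ge0.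
have t0 : 0 < t by rewrite !divr_gt0.
have inball s s' : `|s| <= `|t| -> `|s'| <= `|t| -> ball x r (s *: u + s' *: v + x).
  move=> st s't; rewrite -ball_normE /= opprD addrCA subrr addr0 normrN.
  apply: (le_lt_trans (ler_normD _ _)); rewrite !normrZ.
  apply: (@le_lt_trans _ _ (t * (`|u| + `|v| + 1))).
    rewrite (gtr0_norm t0) in st s't; rewrite !mulrDr mulr1.
    apply: ler_wpDr; first exact: ltW.
    by apply: lerD; apply: ler_wpM2r.
  by rewrite /t divfK ?gt_eqF // ltr_pdivrMr // ltr_pMr // ltr1n.
have [s1 [s1' [h1 h1' E1]]] := second_difference sf
  (fun s s' hs hs' => let: And3 d _ _ := rP _ (inball s s' hs hs') in d).
have inball' s s' : `|s| <= `|t| -> `|s'| <= `|t| -> ball x r (s *: v + s' *: u + x).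
  by move=> st s't; rewrite (addrC (s *: v)); exact: inball.
have [s2 [s2' [h2 h2' E2]]] := second_difference sf
  (fun s s' hs hs' => let: And3 d _ _ := rP _ (inball' s s' hs hs') in d).
have E : 'D_v ('D_u f) (s1 *: u + s1' *: v + x) =
         'D_u ('D_v f) (s2 *: v + s2' *: u + x).
  have tN0 : t != 0 by rewrite gt_eqF.
  apply: (mulfI tN0); apply: (mulfI tN0).
  have swap (a b c d : R) : a - b - (c - d) = a - c - (b - d) by ring.
  apply: etrans (esym E1) _; apply: etrans _ E2.
  by rewrite [X in f X](addrCA (t *: v)); exact: swap.
have [_ _ A] := rP _ (inball _ _ h1 h1').
have [_ B _] := rP _ (inball' _ _ h2 h2').
rewrite E distrC in A; rewrite [e]splitr -(subrKA ('D_u ('D_v f) (s2 *: v + s2' *: u + x))).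
exact: le_trans (ler_normD _ _) (lerD B A).
Qed.

End Schwarz.

Section SchwarzMatrix.
Context {R : realType} {V : normedModType R} {p q : nat}.
Context (D : set V) (Dop : open D).

Lemma derive_comm_mx (F : V -> 'M[R]_(p, q)) x u v : smooth D F -> D x ->
  'D_u ('D_v F) x = 'D_v ('D_u F) x.
Proof.
move=> sF Dx; apply/matrixP => i j.
have E w w' : 'D_w ('D_w' F) x i j = 'D_w ('D_w' (fun y => F y i j)) x.
  rewrite derive_entry; last first.
    exact: (smooth_differentiable (smooth_derive w' sF)).
  apply: (derive_eq_open Dop) => // y Dy.
  by rewrite derive_entry //; exact: smooth_differentiable Dy.
apply: etrans (E u v) _; apply: etrans _ (esym (E v u)).
exact: (derive_comm Dop u v (smooth_entry i j Dop sF) Dx).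
Qed.

End SchwarzMatrix.

(** * Determinant and inverse of a smooth matrix function *)

Section SmoothInverse.
Context {R : realType} {V : normedModType R} (D : set V) (Dop : open D).

Lemma smooth_det n (F : V -> 'M[R]_n) :
  smooth D F -> smooth D (fun x => \det (F x)).
Proof.
move=> sF; apply: (smooth_sum Dop) => s; apply: (smoothMr Dop).
  exact: smooth_cst.
by apply: (smooth_prod Dop) => i; exact: smooth_entry.
Qed.

(** Cramer's rule: the inverse is the adjugate divided by the determinant, and the entries of both
    are polynomial in those of [F x]. *)
Lemma smooth_invmx n (F : V -> 'M[R]_n) : (forall x, D x -> F x \in unitmx) ->
  smooth D F -> smooth D (fun x => invmx (F x)).
Proof.
move=> Fu sF.
have H : smooth D (fun x => (\det (F x))^-1 *: \adj (F x)).
  apply: (smoothM Dop).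
    apply: (smoothV Dop) => [x Dx|]; last exact: smooth_det.
    by rewrite -unitfE -unitmxE Fu.
  apply: (smooth_mx Dop) => i j.
  have H : smooth D (fun x => cofactor (F x) j i).
    apply: (smoothMr Dop); first exact: smooth_cst.
    apply: smooth_det; apply: (smooth_mx Dop) => k l.
    apply: (smooth_eq Dop _ (smooth_entry (lift j k) (lift i l) Dop sF)) => x _.
    by rewrite !mxE.
  by apply: (smooth_eq Dop _ H) => x _; rewrite mxE.
by apply: (smooth_eq Dop _ H) => x Dx; rewrite /invmx Fu.
Qed.

End SmoothInverse.

(* Sealed, so that unification never unfolds the limit in 'D. *)
HB.lock Definition dd {R : realType} {U V : normedModType R}
  (v : U) (f : U -> V) : U -> V := 'D_v f.

Section SealedDerivative.
Context {R : realType} {U V : normedModType R} {E : set U} (Eop : open E).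
Implicit Types (a b f : U -> V) (u v w x : U).

Lemma ddE v f x : dd v f x = 'D_v f x.
Proof. by rewrite unlock. Qed.

Lemma smooth_dd v f : smooth E f -> smooth E (dd v f).
Proof. by rewrite unlock; exact: smooth_derive. Qed.

Lemma dd_eq a b x v : (forall y, E y -> a y = b y) -> E x -> dd v a x = dd v b x.
Proof. by rewrite !ddE; exact: (derive_eq_open Eop). Qed.

Lemma dd_cst v (c : V) x : dd v (fun=> c) x = 0.
Proof. by rewrite ddE; exact: derive_cst. Qed.

Lemma ddD v a b x : smooth E a -> smooth E b -> E x ->
  dd v (fun y => a y + b y) x = dd v a x + dd v b x.
Proof.
move=> sa sb Ex; rewrite !ddE; apply: deriveD.
  exact: diff_derivable (smooth_differentiable sa Ex).
exact: diff_derivable (smooth_differentiable sb Ex).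
Qed.

Lemma ddZ v c a x : smooth E a -> E x ->
  dd v (fun y => c *: a y) x = c *: dd v a x.
Proof.
move=> sa Ex; rewrite !ddE; apply: deriveZ.
exact: diff_derivable (smooth_differentiable sa Ex).
Qed.

Lemma ddN v a x : smooth E a -> E x -> dd v (fun y => - a y) x = - dd v a x.
Proof.
move=> sa Ex; rewrite !ddE; apply: deriveN.
exact: diff_derivable (smooth_differentiable sa Ex).
Qed.

Lemma ddB v a b x : smooth E a -> smooth E b -> E x ->
  dd v (fun y => a y - b y) x = dd v a x - dd v b x.
Proof. by move=> sa sb Ex; rewrite ddD ?ddN //; exact: (smoothN Eop). Qed.

Lemma dd_sum v (I : Type) (s : seq I) (P : pred I) (F : I -> U -> V) x :
  (forall i, smooth E (F i)) -> E x ->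
  dd v (fun y => \sum_(i <- s | P i) F i y) x = \sum_(i <- s | P i) dd v (F i) x.
Proof.
move=> sF Ex; elim: s => [|i s IH].
  rewrite big_nil -[RHS](dd_cst v 0 x); apply: dd_eq => // y _.
  by rewrite big_nil.
rewrite big_cons; case: ifP => Pi.
  rewrite -IH -ddD //; last exact: (smooth_sum Eop).
  by apply: dd_eq => // y _; rewrite big_cons Pi.
by rewrite -IH; apply: dd_eq => // y _; rewrite big_cons Pi.
Qed.

Lemma dd_linear f x : smooth E f -> E x -> linear (fun v => dd v f x).
Proof.
move=> sf Ex c u v; have df := smooth_differentiable sf Ex.
by rewrite !ddE !deriveE // linearP.
Qed.

End SealedDerivative.

Lemma dd_id {R : realType} {U : normedModType R} (v x : U) : dd v id x = v.
Proof. by rewrite ddE; exact: derive_id. Qed.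

Lemma dd_comm {R : realType} {V : normedModType R} {n : nat} (E : set V)
    (Eop : open E) (f : V -> 'rV[R]_n) x u v :
  smooth E f -> E x -> dd u (dd v f) x = dd v (dd u f) x.
Proof. by rewrite unlock; exact: (derive_comm_mx Eop). Qed.

Section SealedLinearArgument.
Context {R : realType} {U V : normedModType R} {n : nat}.
Variables (E : set U) (Eop : open E).
Variables (L : U -> 'rV[R]_n -> V) (a : U -> 'rV[R]_n).
Hypothesis Llin : forall x, E x -> linear (L x).
Hypothesis sL : forall u, smooth E (L ^~ u).
Hypothesis sa : smooth E a.

Lemma smooth_lin : smooth E (fun x => L x (a x)).
Proof. exact: (smooth_linear_arg Eop). Qed.

Lemma dd_lin w x : E x ->
  dd w (fun y => L y (a y)) x = dd w (L ^~ (a x)) x + L x (dd w a x).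
Proof.
move=> Ex; rewrite !ddE; apply: (derive_linear_arg Eop) => // [u|].
  exact: (smooth_differentiable (sL u)).
exact: (smooth_differentiable sa).
Qed.

End SealedLinearArgument.

Lemma dd_chain {R : realType} {U V W : normedModType R} (E : set U)
    (D : set V) (f : U -> V) (g : V -> W) w x :
  smooth E f -> smooth D g -> E x -> D (f x) ->
  dd w (fun y => g (f y)) x = dd (dd w f x) g (f x).
Proof.
move=> sf sg Ex Dfx; rewrite !ddE; apply: derive_comp.
  exact: smooth_differentiable Ex.
exact: smooth_differentiable Dfx.
Qed.

(** The derivative of the composite is a sum of entries of the derivative of [f] times partial
    derivatives of [g] composed with [f]. The induction is therefore on the order with [g] varying
    and [f] fixed. *)
Lemma smooth_chain {R : realType} {U : normedModType R} {n : nat}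
    {W : normedModType R} (E : set U) (D : set 'rV[R]_n) (f : U -> 'rV[R]_n)
    (g : 'rV[R]_n -> W) :
  open E -> (forall x, E x -> D (f x)) ->
  smooth E f -> smooth D g -> smooth E (fun y => g (f y)).
Proof.
move=> Eop fE sf sg k; elim: k g sg => //= k IH g sg; split=> [x Ex|v].
  apply: differentiable_comp; first exact: smooth_differentiable Ex.
  exact: smooth_differentiable (fE x Ex).
have H : times_diff k E (fun x => \sum_a dd v f x ord0 a *: dd (delta_mx ord0 a) g (f x)).
  apply: (times_diff_sum Eop) => a; apply: (times_diffM Eop).
    by apply: (smooth_entry _ _ Eop); exact: smooth_dd.
  by apply: IH; exact: smooth_dd.
apply: (times_diff_eq Eop _ H) => x Ex.
rewrite -[RHS]ddE (dd_chain _ sf sg) ?fE //; last exact: fE.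
have Dfx := fE x Ex; have L := dd_linear sg Dfx.
pose LM := GRing.isLinear.Build _ _ _ _ _ L.
pose LL : {linear 'rV[R]_n -> W} := HB.pack (fun w => dd w g (f x)) LM.
rewrite -[dd _ g (f x)]/(LL _) [in RHS](row_sum_delta (dd v f x)) linear_sum.
by apply: eq_bigr => a _; rewrite linearZ.
Qed.

(** * Connections and curvature *)

Section LinearProp.
Context {R : realType} {V W : normedModType R} (f : V -> W) (fL : linear f).

(** Linearity in one slot of a multilinear expression is available only as a proposition, often only
    at points of [D]. Packing it locally makes the general laws of linear maps usable for such
    proofs. *)
Let F : {linear V -> W} :=
  HB.pack f (GRing.isLinear.Build _ _ _ _ _ fL).

Lemma linear_propD u v : f (u + v) = f u + f v.
Proof. exact: (linearD F). Qed.

Lemma linear_propN u : f (- u) = - f u.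
Proof. exact: (linearN F). Qed.

Lemma linear_propB u v : f (u - v) = f u - f v.
Proof. exact: (linearB F). Qed.

Lemma linear_propZ c u : f (c *: u) = c *: f u.
Proof. exact: (linearZ_LR F). Qed.

Lemma linear_prop0 : f 0 = 0.
Proof. exact: (linear0 F). Qed.

Lemma linear_prop_sum (I : Type) (s : seq I) (P : pred I) (g : I -> V) :
  f (\sum_(i <- s | P i) g i) = \sum_(i <- s | P i) f (g i).
Proof. exact: (linear_sum F). Qed.

End LinearProp.

(** The curvature as a tensor at the point [x]: for vectors extended with constant components the
    bracket vanishes and only these four terms remain. The agreement with the curvature of fields is
    [curvE]. *)
HB.lock Definition curvature {R : realType} {m : nat}
  (Gam : 'rV[R]_m -> 'rV[R]_m -> 'rV[R]_m -> 'rV[R]_m) (x u v w : 'rV[R]_m) :=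
  dd u (fun y => Gam y v w) x - dd v (fun y => Gam y u w) x
  + Gam x u (Gam x v w) - Gam x v (Gam x u w).

(* (nabla_t R)(u, v) w *)
HB.lock Definition dcurvature {R : realType} {m : nat}
  (Gam : 'rV[R]_m -> 'rV[R]_m -> 'rV[R]_m -> 'rV[R]_m) (x t u v w : 'rV[R]_m) :=
  dd t (fun y => curvature Gam y u v w) x + Gam x t (curvature Gam x u v w)
  - curvature Gam x (Gam x t u) v w - curvature Gam x u (Gam x t v) w
  - curvature Gam x u v (Gam x t w).

(* Covariant derivative, in the constant direction s, of a field a along f. *)
HB.lock Definition pcov {R : realType} {m : nat}
  (Gam : 'rV[R]_m -> 'rV[R]_m -> 'rV[R]_m -> 'rV[R]_m) {U : normedModType R}
  (f : U -> 'rV[R]_m) (s : U) (a : U -> 'rV[R]_m) : U -> 'rV[R]_m :=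
  fun y => dd s a y + Gam (f y) (dd s f y) (a y).

(* A torsion-free connection, given by its Christoffel map Gam. *)
Record connection {R : realType} {m : nat} (D : set 'rV[R]_m)
    (Gam : 'rV[R]_m -> 'rV[R]_m -> 'rV[R]_m -> 'rV[R]_m) : Prop := Connection {
  connection_open : open D;
  Gam_linearl : forall x v, linear (fun u => Gam x u v);
  Gam_linearr : forall x u, linear (Gam x u);
  Gam_smooth : forall u v, smooth D (fun x => Gam x u v);
  Gam_sym : forall x u v, D x -> Gam x u v = Gam x v u
}.

Section Connection.
Context {R : realType} {m : nat} (D : set 'rV[R]_m).
Variable Gam : 'rV[R]_m -> 'rV[R]_m -> 'rV[R]_m -> 'rV[R]_m.
Hypothesis GamP : connection D Gam.
Implicit Types x u v w t : 'rV[R]_m.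

Let Dop := connection_open GamP.
Let GL := Gam_linearl GamP.
Let GR := Gam_linearr GamP.
Let sG := Gam_smooth GamP.
Local Notation Rm := (curvature Gam).
Local Notation dG x t u v := (dd t (fun y => Gam y u v) x).

Lemma GamDl x u u' v : Gam x (u + u') v = Gam x u v + Gam x u' v.
Proof. exact: (linear_propD (GL x v)). Qed.
Lemma GamDr x u v v' : Gam x u (v + v') = Gam x u v + Gam x u v'.
Proof. exact: (linear_propD (GR x u)). Qed.
Lemma GamZl x c u v : Gam x (c *: u) v = c *: Gam x u v.
Proof. exact: (linear_propZ (GL x v)). Qed.
Lemma GamZr x c u v : Gam x u (c *: v) = c *: Gam x u v.
Proof. exact: (linear_propZ (GR x u)). Qed.
Lemma GamNl x u v : Gam x (- u) v = - Gam x u v.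
Proof. exact: (linear_propN (GL x v)). Qed.
Lemma GamNr x u v : Gam x u (- v) = - Gam x u v.
Proof. exact: (linear_propN (GR x u)). Qed.
Definition Gam_lin := (GamDl, GamDr, GamNl, GamNr, GamZl, GamZr).

Lemma dGam_linear1 x u v : D x -> linear (fun t => dG x t u v).
Proof. by move=> Dx; apply: dd_linear. Qed.

Lemma dGam_linear2 x t v : D x -> linear (fun u => dG x t u v).
Proof.
move=> Dx c u u'.
rewrite -(ddZ t c (sG u v) Dx) -(ddD t (smoothZ Dop c (sG u v)) (sG u' v) Dx).
by apply: (dd_eq Dop) => // y _; rewrite GamDl GamZl.
Qed.

Lemma dGam_linear3 x t u : D x -> linear (fun v => dG x t u v).
Proof.
move=> Dx c v v'.
rewrite -(ddZ t c (sG u v) Dx) -(ddD t (smoothZ Dop c (sG u v)) (sG u v') Dx).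
by apply: (dd_eq Dop) => // y _; rewrite GamDr GamZr.
Qed.

Lemma dGam_sym x t u v : D x -> dG x t u v = dG x t v u.
Proof. by move=> Dx; apply: (dd_eq Dop) => // y Dy; exact: (Gam_sym GamP). Qed.

Lemma curvature_linear1 x v w : D x -> linear (fun u => Rm x u v w).
Proof.
move=> Dx c u u'; rewrite !curvature.unlock.
rewrite (dGam_linear1 v w Dx) (dGam_linear2 v w Dx) !Gam_lin.
row_ring.
Qed.

Lemma curvatureC x u v w : Rm x u v w = - Rm x v u w.
Proof. rewrite !curvature.unlock; row_ring. Qed.

Lemma curvature_linear2 x u w : D x -> linear (fun v => Rm x u v w).
Proof.
move=> Dx c v v'; rewrite ![Rm x u _ _]curvatureC (curvature_linear1 u w Dx).
row_ring.
Qed.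

Lemma curvature_linear3 x u v : D x -> linear (Rm x u v).
Proof.
move=> Dx c w w'; rewrite !curvature.unlock.
rewrite (dGam_linear3 u v Dx) (dGam_linear3 v u Dx) !Gam_lin.
row_ring.
Qed.

Lemma curvature_bianchi x u v w : D x ->
  Rm x u v w + Rm x v w u + Rm x w u v = 0.
Proof.
move=> Dx; rewrite !curvature.unlock.
rewrite (dGam_sym v w u) // (dGam_sym u w v) // (dGam_sym w v u) //.
rewrite (Gam_sym GamP w u) // (Gam_sym GamP v u) // (Gam_sym GamP w v) //.
row_ring.
Qed.

Lemma smooth_Gam (a b : 'rV[R]_m -> 'rV[R]_m) : smooth D a -> smooth D b ->
  smooth D (fun x => Gam x (a x) (b x)).
Proof.
move=> sa sb; apply: (smooth_lin Dop (L := fun x u => Gam x u (b x))) => //.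
by move=> u; apply: (smooth_lin Dop (L := fun x => Gam x u)).
Qed.

Lemma smooth_curvature u v w : smooth D (fun x => Rm x u v w).
Proof.
rewrite curvature.unlock.
apply: (smoothB Dop); last first.
  by apply: smooth_Gam => //; exact: smooth_cst.
apply: (smoothD Dop); last first.
  by apply: smooth_Gam => //; exact: smooth_cst.
by apply: (smoothB Dop); exact: smooth_dd.
Qed.

Lemma curvatureDl x u u' v w : D x -> Rm x (u + u') v w = Rm x u v w + Rm x u' v w.
Proof. by move=> Dx; exact: (linear_propD (curvature_linear1 v w Dx)). Qed.
Lemma curvatureDm x u v v' w : D x -> Rm x u (v + v') w = Rm x u v w + Rm x u v' w.
Proof. by move=> Dx; exact: (linear_propD (curvature_linear2 u w Dx)). Qed.
Lemma curvatureDr x u v w w' : D x -> Rm x u v (w + w') = Rm x u v w + Rm x u v w'.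
Proof. by move=> Dx; exact: (linear_propD (curvature_linear3 u v Dx)). Qed.
Lemma curvatureZl x c u v w : D x -> Rm x (c *: u) v w = c *: Rm x u v w.
Proof. by move=> Dx; exact: (linear_propZ (curvature_linear1 v w Dx)). Qed.
Lemma curvatureZm x c u v w : D x -> Rm x u (c *: v) w = c *: Rm x u v w.
Proof. by move=> Dx; exact: (linear_propZ (curvature_linear2 u w Dx)). Qed.
Lemma curvatureZr x c u v w : D x -> Rm x u v (c *: w) = c *: Rm x u v w.
Proof. by move=> Dx; exact: (linear_propZ (curvature_linear3 u v Dx)). Qed.
Lemma curvatureNl x u v w : D x -> Rm x (- u) v w = - Rm x u v w.
Proof. by move=> Dx; exact: (linear_propN (curvature_linear1 v w Dx)). Qed.
Lemma curvatureNm x u v w : D x -> Rm x u (- v) w = - Rm x u v w.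
Proof. by move=> Dx; exact: (linear_propN (curvature_linear2 u w Dx)). Qed.
Lemma curvatureNr x u v w : D x -> Rm x u v (- w) = - Rm x u v w.
Proof. by move=> Dx; exact: (linear_propN (curvature_linear3 u v Dx)). Qed.
Definition curvature_lin := (curvatureDl, curvatureDm, curvatureDr,
  curvatureNl, curvatureNm, curvatureNr, curvatureZl, curvatureZm, curvatureZr).

Lemma curvature_id x u w : Rm x u u w = 0.
Proof.
apply: (scalerI (a := 2 : R)); first by rewrite pnatr_eq0.
by rewrite scaler0 scaler_nat mulr2n -[X in X + _]opprK -curvatureC addNr.
Qed.

Local Notation nR := (dcurvature Gam).

Lemma dcurvatureN1 x t u v w : D x -> nR x (- t) u v w = - nR x t u v w.
Proof.
move=> Dx; rewrite !dcurvature.unlock.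
rewrite (linear_propN (dd_linear (smooth_curvature u v w) Dx)).
rewrite !Gam_lin !curvature_lin //; row_ring.
Qed.

Lemma dcurvatureC x t u v w : D x -> nR x t u v w = - nR x t v u w.
Proof.
move=> Dx; rewrite !dcurvature.unlock.
have -> : dd t (fun y => Rm y u v w) x = - dd t (fun y => Rm y v u w) x.
  rewrite -(ddN t (smooth_curvature v u w) Dx).
  by apply: (dd_eq Dop) => // y _; exact: curvatureC.
rewrite (curvatureC x u v w) (curvatureC x _ v w) (curvatureC x u).
rewrite (curvatureC x u v) !Gam_lin; row_ring.
Qed.

Lemma dcurvature_id x t u w : D x -> nR x t u u w = 0.
Proof.
move=> Dx; apply: (scalerI (a := 2 : R)); first by rewrite pnatr_eq0.
rewrite scaler0 scaler_nat mulr2n -[X in X + _]opprK -dcurvatureC //.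
by rewrite addNr.
Qed.

Lemma dcurvatureN3 x t u v w : D x -> nR x t u (- v) w = - nR x t u v w.
Proof.
move=> Dx; rewrite !dcurvature.unlock.
have -> : dd t (fun y => Rm y u (- v) w) x = - dd t (fun y => Rm y u v w) x.
  rewrite -(ddN t (smooth_curvature u v w) Dx).
  by apply: (dd_eq Dop) => // y Dy; exact: curvatureNm.
rewrite !Gam_lin !curvature_lin // !Gam_lin; row_ring.
Qed.

Section Pullback.
Context {U : normedModType R} (E : set U) (Eop : open E) (f : U -> 'rV[R]_m).
Hypothesis fE : forall y, E y -> D (f y).
Hypothesis sf : smooth E f.
Implicit Types (a b c : U -> 'rV[R]_m) (y s : U).

Lemma smooth_Gam_pull a b : smooth E a -> smooth E b ->
  smooth E (fun y => Gam (f y) (a y) (b y)).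
Proof.
move=> sa sb; apply: (smooth_lin Eop (L := fun y u => Gam (f y) u (b y))) => //.
move=> u; apply: (smooth_lin Eop (L := fun y => Gam (f y) u)) => // v.
exact: (smooth_chain (g := fun x => Gam x u v) Eop fE).
Qed.

Lemma dd_Gam_pull a b s y : smooth E a -> smooth E b -> E y ->
  dd s (fun y => Gam (f y) (a y) (b y)) y =
  dG (f y) (dd s f y) (a y) (b y) + Gam (f y) (dd s a y) (b y)
  + Gam (f y) (a y) (dd s b y).
Proof.
move=> sa sb Ey.
have sGf u v : smooth E (fun y => Gam (f y) u v).
  exact: (smooth_chain (g := fun x => Gam x u v) Eop fE).
have sGb u : smooth E (fun y => Gam (f y) u (b y)).
  by apply: (smooth_lin Eop (L := fun y => Gam (f y) u)).
have -> : dd s (fun y => Gam (f y) (a y) (b y)) y =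
    dd s (fun z => Gam (f z) (a y) (b z)) y + Gam (f y) (dd s a y) (b y).
  exact: (dd_lin Eop (L := fun y u => Gam (f y) u (b y))).
have -> : dd s (fun z => Gam (f z) (a y) (b z)) y =
    dd s (fun z => Gam (f z) (a y) (b y)) y + Gam (f y) (a y) (dd s b y).
  by apply: (dd_lin Eop (L := fun z => Gam (f z) (a y))).
have -> : dd s (fun z => Gam (f z) (a y) (b y)) y =
    dG (f y) (dd s f y) (a y) (b y).
  by apply: (dd_chain (g := fun x => Gam x (a y) (b y)) _ sf _ Ey); [exact: sG|exact: fE].
row_ring.
Qed.


Lemma smooth_curvature_pull a b c : smooth E a -> smooth E b -> smooth E c ->
  smooth E (fun y => Rm (f y) (a y) (b y) (c y)).
Proof.
move=> sa sb sc.
apply: (smooth_lin Eop (L := fun y u => Rm (f y) u (b y) (c y))) => // [y Ey|u].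
  by apply: curvature_linear1; exact: fE.
apply: (smooth_lin Eop (L := fun y v => Rm (f y) u v (c y))) => // [y Ey|v].
  by apply: curvature_linear2; exact: fE.
apply: (smooth_lin Eop (L := fun y => Rm (f y) u v)) => // [y Ey|w].
  by apply: curvature_linear3; exact: fE.
exact: (smooth_chain (g := fun x => Rm x u v w) Eop fE sf (smooth_curvature _ _ _)).
Qed.

Lemma dd_curvature_pull a b c s y :
  smooth E a -> smooth E b -> smooth E c -> E y ->
  dd s (fun y => Rm (f y) (a y) (b y) (c y)) y =
  dd (dd s f y) (fun x => Rm x (a y) (b y) (c y)) (f y)
  + Rm (f y) (dd s a y) (b y) (c y) + Rm (f y) (a y) (dd s b y) (c y)
  + Rm (f y) (a y) (b y) (dd s c y).
Proof.
move=> sa sb sc Ey.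
have sk (k : 'rV[R]_m) : smooth E (fun=> k) by exact: smooth_cst.
have -> : dd s (fun y => Rm (f y) (a y) (b y) (c y)) y =
    dd s (fun z => Rm (f z) (a y) (b z) (c z)) y + Rm (f y) (dd s a y) (b y) (c y).
  apply: (dd_lin Eop (L := fun y u => Rm (f y) u (b y) (c y))) => // [z Ez|u].
    by apply: curvature_linear1; exact: fE.
  exact: smooth_curvature_pull.
have -> : dd s (fun z => Rm (f z) (a y) (b z) (c z)) y =
    dd s (fun z => Rm (f z) (a y) (b y) (c z)) y + Rm (f y) (a y) (dd s b y) (c y).
  apply: (dd_lin Eop (L := fun z u => Rm (f z) (a y) u (c z))) => // [z Ez|u].
    by apply: curvature_linear2; exact: fE.
  exact: smooth_curvature_pull.
have -> : dd s (fun z => Rm (f z) (a y) (b y) (c z)) y =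
    dd s (fun z => Rm (f z) (a y) (b y) (c y)) y + Rm (f y) (a y) (b y) (dd s c y).
  apply: (dd_lin Eop (L := fun z => Rm (f z) (a y) (b y))) => // [z Ez|u].
    by apply: curvature_linear3; exact: fE.
  exact: smooth_curvature_pull.
have -> : dd s (fun z => Rm (f z) (a y) (b y) (c y)) y =
    dd (dd s f y) (fun x => Rm x (a y) (b y) (c y)) (f y).
  by apply: (dd_chain (g := fun x => Rm x (a y) (b y) (c y)) _ sf _ Ey);
    [exact: smooth_curvature|exact: fE].
row_ring.
Qed.

Local Notation pcov := (pcov Gam f).

Lemma pcovE s a y : pcov s a y = dd s a y + Gam (f y) (dd s f y) (a y).
Proof. by rewrite unlock. Qed.

Lemma smooth_pcov s a : smooth E a -> smooth E (pcov s a).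
Proof.
move=> sa; rewrite unlock; apply: (smoothD Eop); first exact: smooth_dd.
by apply: smooth_Gam_pull => //; exact: smooth_dd.
Qed.

Lemma pcovD s a b y : smooth E a -> smooth E b -> E y ->
  pcov s (fun y => a y + b y) y = pcov s a y + pcov s b y.
Proof.
move=> sa sb Ey; rewrite !pcovE (ddD s sa sb Ey) GamDr; row_ring.
Qed.

Lemma pcovZ s k a y : smooth E a -> E y ->
  pcov s (fun y => k *: a y) y = k *: pcov s a y.
Proof. by move=> sa Ey; rewrite !pcovE (ddZ s k sa Ey) GamZr scalerDr. Qed.

Lemma pcov_curvature s a b c y :
  smooth E a -> smooth E b -> smooth E c -> E y ->
  pcov s (fun y => Rm (f y) (a y) (b y) (c y)) y =
  nR (f y) (dd s f y) (a y) (b y) (c y)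
  + Rm (f y) (pcov s a y) (b y) (c y) + Rm (f y) (a y) (pcov s b y) (c y)
  + Rm (f y) (a y) (b y) (pcov s c y).
Proof.
move=> sa sb sc Ey; have Dfy := fE Ey.
rewrite !pcovE (dd_curvature_pull s sa sb sc Ey) dcurvature.unlock !curvature_lin //.
row_ring.
Qed.

(** The curvature of a pull-back connection is the pull-back of the curvature. The second
    derivatives of [a] and of [f] are symmetric, the cross terms are exchanged by swapping [s] and
    [t], and what is left is the definition of [curvature]. *)
Lemma pcov_comm s (t : U) a y : smooth E a -> E y ->
  pcov s (pcov t a) y - pcov t (pcov s a) y =
  Rm (f y) (dd s f y) (dd t f y) (a y).
Proof.
move=> sa Ey; have Dfy := fE Ey.
have E1 (p q : U) : pcov p (pcov q a) y =
    dd p (dd q a) y + dG (f y) (dd p f y) (dd q f y) (a y)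
    + Gam (f y) (dd p (dd q f) y) (a y) + Gam (f y) (dd q f y) (dd p a y)
    + Gam (f y) (dd p f y) (dd q a y)
    + Gam (f y) (dd p f y) (Gam (f y) (dd q f y) (a y)).
  rewrite pcovE {1}pcov.unlock (ddD p (smooth_dd q sa)
    (smooth_Gam_pull (smooth_dd q sf) sa) Ey).
  rewrite (dd_Gam_pull p (smooth_dd q sf) sa Ey) pcovE GamDr; row_ring.
rewrite !E1 curvature.unlock (dd_comm Eop t s sa Ey) (dd_comm Eop t s sf Ey).
row_ring.
Qed.

End Pullback.
End Connection.

(* Sections along a map F = (f, y) into the tangent bundle are written
   a^h + b^v; covH and covV are the horizontal and vertical components of
   the covariant derivative of a^h + b^v for the Sasaki metric. *)
Section SplitConnection.
Context {R : realType} {m : nat} (D : set 'rV[R]_m).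
Variable Gam : 'rV[R]_m -> 'rV[R]_m -> 'rV[R]_m -> 'rV[R]_m.
Hypothesis GamP : connection D Gam.
Context {U : normedModType R} (E : set U) (Eop : open E).
Variables (f y : U -> 'rV[R]_m).
Hypothesis fE : forall z, E z -> D (f z).
Hypothesis sf : smooth E f.
Hypothesis sy : smooth E y.
Implicit Types (a b c : U -> 'rV[R]_m) (s t z : U).

Local Notation Rm := (curvature Gam).
Local Notation nR := (dcurvature Gam).
Local Notation cov := (pcov Gam f).

Definition covH s a b z := cov s a z
  + 2^-1 *: (Rm (f z) (y z) (b z) (dd s f z) + Rm (f z) (y z) (cov s y z) (a z)).

Definition covV s a b z := cov s b z - 2^-1 *: Rm (f z) (dd s f z) (a z) (y z).

Lemma smooth_covH s a b : smooth E a -> smooth E b -> smooth E (covH s a b).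
Proof.
move=> sa sb; have sfs := smooth_dd s sf.
have sys := smooth_pcov GamP Eop fE sf s sy.
apply: (smoothD Eop); first exact: (smooth_pcov GamP).
apply: (smoothZ Eop); apply: (smoothD Eop);
  exact: (smooth_curvature_pull GamP Eop fE sf).
Qed.

Lemma smooth_covV s a b : smooth E a -> smooth E b -> smooth E (covV s a b).
Proof.
move=> sa sb; have sfs := smooth_dd s sf.
apply: (smoothB Eop); first exact: (smooth_pcov GamP).
by apply: (smoothZ Eop); exact: (smooth_curvature_pull GamP Eop fE sf).
Qed.

Lemma pcov_torsion s t z : E z -> cov s (dd t f) z = cov t (dd s f) z.
Proof.
move=> Ez; rewrite !pcovE (dd_comm Eop s t sf Ez).
by rewrite (Gam_sym GamP _ _ (fE Ez)).
Qed.

Lemma pcov_covH s t a b z : smooth E a -> smooth E b -> E z ->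
  cov s (covH t a b) z = cov s (cov t a) z + 2^-1 *: (
    nR (f z) (dd s f z) (y z) (b z) (dd t f z)
    + Rm (f z) (cov s y z) (b z) (dd t f z)
    + Rm (f z) (y z) (cov s b z) (dd t f z)
    + Rm (f z) (y z) (b z) (cov s (dd t f) z)
    + nR (f z) (dd s f z) (y z) (cov t y z) (a z)
    + Rm (f z) (cov s y z) (cov t y z) (a z)
    + Rm (f z) (y z) (cov s (cov t y) z) (a z)
    + Rm (f z) (y z) (cov t y z) (cov s a z)).
Proof.
move=> sa sb Ez; have sft := smooth_dd t sf.
have syt := smooth_pcov GamP Eop fE sf t sy.
have sta := smooth_pcov GamP Eop fE sf t sa.
have s1 := smooth_curvature_pull GamP Eop fE sf sy sb sft.
have s2 := smooth_curvature_pull GamP Eop fE sf sy syt sa.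
rewrite /covH (pcovD GamP f s sta (smoothZ Eop _ (smoothD Eop s1 s2)) Ez).
rewrite (pcovZ GamP f s _ (smoothD Eop s1 s2) Ez) (pcovD GamP f s s1 s2 Ez).
rewrite (pcov_curvature GamP Eop fE sf s sy sb sft Ez).
rewrite (pcov_curvature GamP Eop fE sf s sy syt sa Ez).
by rewrite !addrA.
Qed.

Lemma pcov_covV s t a b z : smooth E a -> smooth E b -> E z ->
  cov s (covV t a b) z = cov s (cov t b) z - 2^-1 *: (
    nR (f z) (dd s f z) (dd t f z) (a z) (y z)
    + Rm (f z) (cov s (dd t f) z) (a z) (y z)
    + Rm (f z) (dd t f z) (cov s a z) (y z)
    + Rm (f z) (dd t f z) (a z) (cov s y z)).
Proof.
move=> sa sb Ez; have sft := smooth_dd t sf.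
have stb := smooth_pcov GamP Eop fE sf t sb.
have s1 := smooth_curvature_pull GamP Eop fE sf sft sa sy.
have -> : covV t a b = (fun z => cov t b z +
    (- 2^-1) *: Rm (f z) (dd t f z) (a z) (y z)).
  by apply/funext => x; rewrite /covV scaleNr.
rewrite (pcovD GamP f s stb (smoothZ Eop _ s1) Ez) (pcovZ GamP f s _ s1 Ez).
by rewrite (pcov_curvature GamP Eop fE sf s sft sa sy Ez) scaleNr.
Qed.

Section Commutator.
Variables (s t : U) (a b : U -> 'rV[R]_m) (z : U).
Hypotheses (sa : smooth E a) (sb : smooth E b) (Ez : E z).
Local Notation x := (f z).
Local Notation p := (y z).
Local Notation u := (dd s f z).
Local Notation v := (dd t f z).
Local Notation w := (a z).
Local Notation ku := (cov s y z).
Local Notation kv := (cov t y z).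
Local Notation kw := (b z).

Let Dx : D x := fE Ez.
Let lin := @curvature_lin R m D Gam GamP.

(** The coefficient 1 of [Rm x ku kv w] is the sum of two halves, one from each order of
    differentiation. The quarters arise where the correction of one operator enters the correction
    of the other. *)
Lemma split_commH :
  covH s (covH t a b) (covV t a b) z
  - covH t (covH s a b) (covV s a b) z =
  Rm x u v w + Rm x ku kv w
  + 2^-1 *: (nR x u p kw v - nR x v p kw u + nR x u p kv w - nR x v p ku w
             + Rm x ku kw v - Rm x kv kw u + Rm x p (Rm x u v p) w)
  + 4^-1 *: (Rm x p (Rm x u w p) v - Rm x p (Rm x v w p) u
             + Rm x p ku (Rm x p kw v + Rm x p kv w)
             - Rm x p kv (Rm x p kw u + Rm x p ku w)).
Proof.
have ca := pcov_comm GamP Eop fE sf s t sa Ez.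
have cy := pcov_comm GamP Eop fE sf s t sy Ez.
rewrite {1}/covH {1}[X in _ - X]/covH !pcov_covH //.
rewrite (pcov_torsion t s Ez).
(* The commutator formulas are used from right to left: replacing [Rm x u v _] by second covariant
   derivatives turns the goal into a linear identity between common atoms. *)
rewrite -ca -cy /covH /covV !lin //.
rewrite (curvatureC Gam x kv ku w).
row_lra.
Qed.

Lemma split_commV :
  covV s (covH t a b) (covV t a b) z
  - covV t (covH s a b) (covV s a b) z =
  Rm x u v kw
  - 2^-1 *: (nR x u v w p - nR x v u w p + Rm x v w ku - Rm x u w kv)
  - 4^-1 *: (Rm x u (Rm x p kw v + Rm x p kv w) p
             - Rm x v (Rm x p kw u + Rm x p ku w) p).
Proof.
have cb := pcov_comm GamP Eop fE sf s t sb Ez.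
rewrite {1}/covV {1}[X in _ - X]/covV !pcov_covV //.
rewrite (pcov_torsion t s Ez).
rewrite -cb /covH /covV !lin //.
row_lra.
Qed.

End Commutator.

End SplitConnection.

Lemma smooth_id {R : realType} {U : normedModType R} (D : set U) :
  smooth D (@id U).
Proof.
move=> [|k] //=; split=> [x _|v]; first by have [] := is_diff_id x.
have -> : 'D_v id = (fun=> v) by apply/funext => x; exact: derive_id.
exact: times_diff_cst.
Qed.

(** * Metric connections *)

Record metric_connection {R : realType} {m : nat} (D : set 'rV[R]_m)
    (Gam : 'rV[R]_m -> 'rV[R]_m -> 'rV[R]_m -> 'rV[R]_m)
    (g : 'rV[R]_m -> 'rV[R]_m -> 'rV[R]_m -> R) : Prop := MetricConnection {
  metric_conn : connection D Gam;
  metric_linearl : forall x v, linear (fun u => g x u v);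
  metric_linearr : forall x u, linear (g x u);
  metric_smooth : forall u v, smooth D (fun x => g x u v);
  metric_sym : forall x u v, D x -> g x u v = g x v u;
  metric_compat : forall x t u v, D x ->
    dd t (fun y => g y u v) x = g x (Gam x t u) v + g x u (Gam x t v)
}.

Section MetricConnection.
Context {R : realType} {m : nat} (D : set 'rV[R]_m).
Variable Gam : 'rV[R]_m -> 'rV[R]_m -> 'rV[R]_m -> 'rV[R]_m.
Variable g : 'rV[R]_m -> 'rV[R]_m -> 'rV[R]_m -> R.
Hypothesis gP : metric_connection D Gam g.
Implicit Types x u v w t s : 'rV[R]_m.

Let GamP := metric_conn gP.
Let Dop := connection_open GamP.
Let gL := metric_linearl gP.
Let gR := metric_linearr gP.
Let sg := metric_smooth gP.
Local Notation Rm := (curvature Gam).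

Lemma metricDl x u u' v : g x (u + u') v = g x u v + g x u' v.
Proof. exact: (linear_propD (gL x v)). Qed.
Lemma metricDr x u v v' : g x u (v + v') = g x u v + g x u v'.
Proof. exact: (linear_propD (gR x u)). Qed.
Lemma metricNl x u v : g x (- u) v = - g x u v.
Proof. exact: (linear_propN (gL x v)). Qed.
Lemma metricNr x u v : g x u (- v) = - g x u v.
Proof. exact: (linear_propN (gR x u)). Qed.
Lemma metricZl x c u v : g x (c *: u) v = c * g x u v.
Proof. exact: (linear_propZ (gL x v)). Qed.
Lemma metricZr x c u v : g x u (c *: v) = c * g x u v.
Proof. exact: (linear_propZ (gR x u)). Qed.
Definition metric_lin :=
  (metricDl, metricDr, metricNl, metricNr, metricZl, metricZr).

Section Pullback.
Context {U : normedModType R} (E : set U) (Eop : open E) (f : U -> 'rV[R]_m).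
Hypothesis fE : forall y, E y -> D (f y).
Hypothesis sf : smooth E f.
Implicit Types (a b : U -> 'rV[R]_m).

Lemma smooth_metric_pull a b : smooth E a -> smooth E b ->
  smooth E (fun y => g (f y) (a y) (b y)).
Proof.
move=> sa sb; apply: (smooth_lin Eop (L := fun y u => g (f y) u (b y))) => // u.
apply: (smooth_lin Eop (L := fun y => g (f y) u)) => // v.
exact: (smooth_chain (g := fun x => g x u v) Eop fE).
Qed.

Lemma dd_metric_pull a b (r y : U) : smooth E a -> smooth E b -> E y ->
  dd r (fun y => g (f y) (a y) (b y)) y =
  g (f y) (pcov Gam f r a y) (b y) + g (f y) (a y) (pcov Gam f r b y).
Proof.
move=> sa sb Ey.
have sgf u v : smooth E (fun y => g (f y) u v).
  exact: (smooth_chain (g := fun x => g x u v) Eop fE).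
have sgb u : smooth E (fun y => g (f y) u (b y)).
  by apply: (smooth_lin Eop (L := fun y => g (f y) u)).
have -> : dd r (fun y => g (f y) (a y) (b y)) y =
    dd r (fun z => g (f z) (a y) (b z)) y + g (f y) (dd r a y) (b y).
  exact: (dd_lin Eop (L := fun y u => g (f y) u (b y))).
have -> : dd r (fun z => g (f z) (a y) (b z)) y =
    dd r (fun z => g (f z) (a y) (b y)) y + g (f y) (a y) (dd r b y).
  by apply: (dd_lin Eop (L := fun z => g (f z) (a y))).
have -> : dd r (fun z => g (f z) (a y) (b y)) y =
    dd (dd r f y) (fun x => g x (a y) (b y)) (f y).
  by apply: (dd_chain (g := fun x => g x (a y) (b y)) _ sf _ Ey);
    [exact: sg|exact: fE].
rewrite (metric_compat gP _ _ _ (fE Ey)) !pcovE !metric_lin; lra.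
Qed.

End Pullback.

(** Differentiating the function g(u, v) along [s] and [t] in both orders gives equal results. The
    terms with one Christoffel map in each slot are symmetric in [s] and [t], so the difference is
    g(R(s, t) u, v) + g(u, R(s, t) v). *)
Lemma curvature_skew x s t u v : D x ->
  g x (Rm x s t u) v = - g x u (Rm x s t v).
Proof.
move=> Dx.
have sk (k : 'rV[R]_m) : smooth D (fun=> k) by exact: smooth_cst.
have sid : smooth D (@id 'rV[R]_m) by exact: smooth_id.
have sG p q : smooth D (fun y => Gam y p q) by exact: (Gam_smooth GamP).
have dg p (a b : 'rV[R]_m -> 'rV[R]_m) : smooth D a -> smooth D b ->
    dd p (fun y => g y (a y) (b y)) x =
    g x (dd p a x + Gam x p (a x)) (b x) + g x (a x) (dd p b x + Gam x p (b x)).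
  move=> sa sb; have := dd_metric_pull Dop (fun y Dy => Dy) sid p sa sb Dx.
  by rewrite !pcovE dd_id.
have K p q : dd p (dd q (fun y => g y u v)) x =
    g x (dd p (fun y => Gam y q u) x + Gam x p (Gam x q u)) v
    + g x (Gam x q u) (Gam x p v) + g x (Gam x p u) (Gam x q v)
    + g x u (dd p (fun y => Gam y q v) x + Gam x p (Gam x q v)).
  rewrite (@dd_eq _ _ _ _ Dop _ (fun y => g y (Gam y q u) v + g y u (Gam y q v))) //; last first.
    by move=> y Dy; rewrite (metric_compat gP).
  have s1 : smooth D (fun y => g y (Gam y q u) v).
    by apply: (smooth_lin Dop (L := fun y w => g y w v)).
  have s2 : smooth D (fun y => g y u (Gam y q v)).
    by apply: (smooth_lin Dop (L := fun y => g y u)).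
  rewrite (ddD p s1 s2 Dx) (dg p _ _ (sG q u) (sk v)) (dg p _ _ (sk u) (sG q v)).
  rewrite !dd_cst !add0r; lra.
have KC : dd s (dd t (fun y => g y u v)) x = dd t (dd s (fun y => g y u v)) x.
  rewrite dd.unlock; exact: (derive_comm Dop s t (sg u v) Dx).
move: KC; rewrite !K curvature.unlock !metric_lin => KC; lra.
Qed.

(** The classical octahedron argument: four instances of the Bianchi identity are combined, and the
    listed skew-symmetries identify enough components for the rest to be linear algebra. *)
Lemma curvature_pair x s t u v : D x ->
  g x (Rm x s t u) v = g x (Rm x u v s) t.
Proof.
move=> Dx.
have B a b c d : g x (Rm x a b c) d + g x (Rm x b c a) d + g x (Rm x c a b) d = 0.
  rewrite -!metricDl (curvature_bianchi GamP) //.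
  exact: (linear_prop0 (gL x d)).
have S a b c d : g x (Rm x a b c) d = - g x (Rm x a b d) c.
  by rewrite curvature_skew // (metric_sym gP).
have A a b c d : g x (Rm x a b c) d = - g x (Rm x b a c) d.
  by rewrite curvatureC metricNl.
have := B s t u v; have := B t u v s; have := B u v s t; have := B v s t u.
have := S s t u v; have := S t u v s; have := S u v s t; have := S v s t u.
have := S s u t v; have := S t v u s; have := S t u s v; have := S u s t v.
have := S u v t s; have := S v t u s; have := S v s u t; have := S s u v t.
have := S t v s u; have := S s t v u.
have := A s t u v; have := A t u v s; have := A u v s t; have := A v s t u.
have := A u s t v; have := A v t u s; have := A s u v t; have := A t v s u.
have := A t u s v; have := A u v t s; have := A v s u t; have := A s t v u.
lra.
Qed.

End MetricConnection.

(** * Koszul formula and Levi-Civita connection *)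

Section Form.
Context {R : realType} {n : nat}.
Implicit Types (A : 'M[R]_n) (u v w : 'rV[R]_n).

Lemma formE A u v :
  form A u v = \sum_i \sum_j u ord0 i * v ord0 j * A i j.
Proof.
rewrite /Defs.form mxE exchange_big; apply: eq_bigr => j _.
rewrite !mxE mulr_suml; apply: eq_bigr => i _; ring.
Qed.

Lemma form_linearl A v : linear (fun u => form A u v).
Proof. by move=> c u w; rewrite /Defs.form !mulmxDl -!scalemxAl !mxE. Qed.

Lemma form_linearr A u : linear (form A u).
Proof. by move=> c v w; rewrite /Defs.form linearP /= mulmxDr -scalemxAr !mxE. Qed.

Lemma form_delta A i j : form A (delta_mx ord0 i) (delta_mx ord0 j) = A i j.
Proof. by rewrite /Defs.form -rowE trmx_delta -colE !mxE. Qed.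

Lemma form_sym A : (forall u v, form A u v = form A v u) -> A^T = A.
Proof.
by move=> As; apply/matrixP => i j; rewrite mxE -!form_delta As.
Qed.

Lemma form_unit A : (forall u, u != 0 -> 0 < form A u u) -> A \in unitmx.
Proof.
move=> Apos; rewrite unitmxE unitfE; apply/det0P => -[u u0 uA].
by have := Apos u u0; rewrite /Defs.form uA mul0mx mxE ltxx.
Qed.

Lemma form_inj A u v : A \in unitmx -> (forall w, form A u w = form A v w) ->
  u = v.
Proof.
move=> Au uv; apply: (can_inj (mulmxK Au)); apply/rowP => j.
by have := uv (delta_mx ord0 j); rewrite /Defs.form trmx_delta -!colE !mxE.
Qed.

End Form.

Section Koszul.
Context {R : realType} {n : nat} (E : set 'rV[R]_n) (Eop : open E).
Variable H : 'rV[R]_n -> 'M[R]_n.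
Hypothesis sH : smooth E H.
Hypothesis Hsym : forall x, E x -> (H x)^T = H x.
Implicit Types (x u v w : 'rV[R]_n).

Lemma smooth_form u v : smooth E (fun x => form (H x) u v).
Proof.
have S : smooth E (fun x => \sum_i \sum_j u ord0 i * v ord0 j * H x i j).
  apply: (smooth_sum Eop) => i; apply: (smooth_sum Eop) => j.
  by apply: (smoothZ Eop); exact: smooth_entry.
by apply: (smooth_eq Eop _ S) => x _; rewrite formE.
Qed.

Lemma dd_form x w u v : E x ->
  dd w (fun y => form (H y) u v) x =
  \sum_a \sum_i \sum_j w ord0 a * u ord0 i * v ord0 j * partial a H x i j.
Proof.
move=> Ex.
rewrite (@dd_eq _ _ _ _ Eop _
  (fun y => \sum_i \sum_j (u ord0 i * v ord0 j) *: H y i j)) //; last first.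
  by move=> y _; rewrite formE.
have s1 i j : smooth E (fun y => (u ord0 i * v ord0 j) *: H y i j).
  by apply: (smoothZ Eop); exact: smooth_entry.
rewrite (dd_sum Eop) // => [|i]; last exact: (smooth_sum Eop).
rewrite exchange_big /=; apply: eq_bigr => i _.
rewrite (dd_sum Eop) // exchange_big /=; apply: eq_bigr => j _.
rewrite (ddZ w _ (smooth_entry i j Eop sH) Ex) ddE.
have dH := smooth_differentiable sH Ex.
rewrite -(derive_entry w i j dH) (derive_partial w dH) summxE scaler_sumr.
by apply: eq_bigr => a _; rewrite mxE /GRing.scale /=; ring.
Qed.

Lemma partial_sym x a i j : E x -> partial a H x i j = partial a H x j i.
Proof.
move=> Ex; have dH := smooth_differentiable sH Ex.
rewrite /partial !(derive_entry _ _ _ dH).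
by apply: (derive_eq_open Eop) => // y Ey; rewrite -[in LHS]Hsym // mxE.
Qed.

Lemma christoffel_sym x k a b : E x -> christoffel H x k a b = christoffel H x k b a.
Proof.
move=> Ex; rewrite /christoffel; congr (_ * _); apply: eq_bigr => l _.
by congr (_ * (_ - _)); [exact: addrC|exact: partial_sym].
Qed.

Lemma Gamma_linearl x v : linear (fun u => Gamma H x u v).
Proof.
move=> c u w; apply/rowP => k; rewrite !mxE mulr_sumr -big_split /=.
apply: eq_bigr => a _; rewrite mulr_sumr -big_split /=.
by apply: eq_bigr => b _; rewrite !mxE; ring.
Qed.

Lemma Gamma_linearr x u : linear (Gamma H x u).
Proof.
move=> c v w; apply/rowP => k; rewrite !mxE mulr_sumr -big_split /=.
apply: eq_bigr => a _; rewrite mulr_sumr -big_split /=.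
by apply: eq_bigr => b _; rewrite !mxE; ring.
Qed.

Lemma Gamma_sym x u v : E x -> Gamma H x u v = Gamma H x v u.
Proof.
move=> Ex; apply/rowP => k; rewrite !mxE exchange_big /=.
apply: eq_bigr => a _; apply: eq_bigr => b _.
by rewrite (christoffel_sym k b a Ex); ring.
Qed.

Hypothesis Hunit : forall x, E x -> H x \in unitmx.

Lemma smooth_Gamma u v : smooth E (fun x => Gamma H x u v).
Proof.
have sI := smooth_invmx Eop Hunit sH.
have sP a i j : smooth E (fun x => partial a H x i j).
  by apply: smooth_entry => //; exact: smooth_derive.
have sC k a b : smooth E (fun x => christoffel H x k a b).
  apply: (smoothZ Eop); apply: (smooth_sum Eop) => l; apply: (smoothMr Eop).
    exact: (smooth_entry k l Eop sI).
  by apply: (smoothB Eop) => //; exact: (smoothD Eop).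
apply: (smooth_mx Eop) => i k.
have S : smooth E (fun x => \sum_a \sum_b
    christoffel H x k a b * u ord0 a * v ord0 b).
  apply: (smooth_sum Eop) => a; apply: (smooth_sum Eop) => b.
  by apply: (smoothMr Eop); [apply: (smoothMr Eop) => //|]; exact: smooth_cst.
by apply: (smooth_eq Eop _ S) => x _; rewrite mxE.
Qed.

(** For constant [u], [v], [w] all brackets vanish, so only the three derivative terms of the Koszul
    formula remain. *)
Lemma koszul x u v w : E x ->
  form (H x) (Gamma H x u v) w =
  2^-1 * (dd u (fun y => form (H y) v w) x + dd v (fun y => form (H y) u w) x
          - dd w (fun y => form (H y) u v) x).
Proof.
move=> Ex; rewrite !dd_form //.
(* Lowering the upper index cancels the inverse matrix in [christoffel] and leaves the Christoffel
   symbols of the first kind. *)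
have chr a b c : \sum_k christoffel H x k a b * H x k c =
    2^-1 * (partial a H x b c + partial b H x a c - partial c H x a b).
  rewrite /christoffel.
  under eq_bigr => k _ do rewrite -mulrA mulr_suml.
  rewrite -mulr_sumr exchange_big /=; congr (_ * _).
  have delta l : \sum_k H x k c * invmx (H x) k l = (c == l)%:R.
    transitivity ((H x *m invmx (H x)) c l); last by rewrite mulmxV ?Hunit // mxE.
    rewrite mxE; apply: eq_bigr => k _; congr (_ * _).
    by rewrite -[in LHS]Hsym // mxE.
  transitivity (\sum_l (c == l)%:R *
      (partial a H x b l + partial b H x a l - partial l H x a b)).
    apply: eq_bigr => l _; rewrite -delta mulr_suml; apply: eq_bigr => k _.
    by rewrite mulrAC [_ * H x k c]mulrC.
  rewrite (bigD1 c) //= eqxx mul1r big1 ?addr0 // => l lc.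
  by rewrite eq_sym (negPf lc) mul0r.
have -> : form (H x) (Gamma H x u v) w = \sum_a \sum_b \sum_c
    u ord0 a * v ord0 b * w ord0 c * (\sum_k christoffel H x k a b * H x k c).
  rewrite formE.
  transitivity (\sum_k \sum_c \sum_a \sum_b
      u ord0 a * v ord0 b * w ord0 c * (christoffel H x k a b * H x k c)).
    apply: eq_bigr => k _; apply: eq_bigr => c _; rewrite mxE !mulr_suml.
    apply: eq_bigr => a _; rewrite !mulr_suml; apply: eq_bigr => b _; ring.
  under eq_bigr => k _ do rewrite exchange_big /=.
  rewrite exchange_big /=; apply: eq_bigr => a _.
  under eq_bigr => k _ do rewrite exchange_big /=.
  rewrite exchange_big /=; apply: eq_bigr => b _.
  rewrite exchange_big /=; apply: eq_bigr => c _; by rewrite mulr_sumr.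
under eq_bigr => a _ do under eq_bigr => b _ do under eq_bigr => c _ do rewrite chr.
set T1 := (X in 2^-1 * (X + _ - _)).
have -> : \sum_a \sum_i \sum_j v ord0 a * u ord0 i * w ord0 j * partial a H x i j =
    \sum_a \sum_b \sum_c u ord0 a * v ord0 b * w ord0 c * partial b H x a c.
  rewrite exchange_big /=; apply: eq_bigr => a _; apply: eq_bigr => b _.
  by apply: eq_bigr => c _; ring.
have -> : \sum_a \sum_i \sum_j w ord0 a * u ord0 i * v ord0 j * partial a H x i j =
    \sum_a \sum_b \sum_c u ord0 a * v ord0 b * w ord0 c * partial c H x a b.
  rewrite exchange_big /=; apply: eq_bigr => a _.
  rewrite exchange_big /=; apply: eq_bigr => b _.
  by apply: eq_bigr => c _; ring.
rewrite /T1 -sumrN -!big_split /= mulr_sumr; apply: eq_bigr => a _.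
rewrite -sumrN -!big_split /= mulr_sumr; apply: eq_bigr => b _.
rewrite -sumrN -!big_split /= mulr_sumr; apply: eq_bigr => c _; ring.
Qed.

End Koszul.

Section LeviCivita.
Context {R : realType} {m : nat} (D : set 'rV[R]_m) (Dop : open D).
Variable G : 'rV[R]_m -> 'M[R]_m.
Hypothesis sG : smooth D G.
Hypothesis Gsym : forall x, D x -> forall u v, form (G x) u v = form (G x) v u.
Hypothesis Gpos : forall x, D x -> forall u, u != 0 -> 0 < form (G x) u u.

Lemma levi_civita : metric_connection D (Gamma G) (fun x => form (G x)).
Proof.
have Gs x : D x -> (G x)^T = G x by move=> Dx; exact/form_sym/Gsym.
have Gu x : D x -> G x \in unitmx by move=> Dx; exact/form_unit/Gpos.
split.
- split=> //.
  + by move=> x v; exact: Gamma_linearl.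
  + by move=> x u; exact: Gamma_linearr.
  + by move=> u v; exact: (smooth_Gamma Dop).
  + by move=> x u v; exact: (Gamma_sym Dop).
- by move=> x v; exact: form_linearl.
- by move=> x u; exact: form_linearr.
- by move=> u v; exact: (smooth_form Dop).
- by move=> x u v Dx; exact: Gsym.
(* Compatibility: in the sum of the Koszul expressions for g(Gamma(t, u), v) and g(Gamma(t, v), u),
   only the derivative along [t] survives, twice, and this is halved. *)
move=> x t u v Dx; rewrite (Gsym Dx u) !(koszul Dop sG Gs Gu) //.
have -> : dd t (fun y => form (G y) v u) x = dd t (fun y => form (G y) u v) x.
  by apply: (dd_eq Dop) => // y Dy; exact: Gsym.
lra.
Qed.

End LeviCivita.

(** * The Sasaki metric *)

Section Sasaki.
Context {R : realType} {m : nat} (D : set 'rV[R]_m) (Dop : open D).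
Variable G : 'rV[R]_m -> 'M[R]_m.
Hypothesis sG : smooth D G.
Hypothesis Gsym : forall x, D x -> forall u v, form (G x) u v = form (G x) v u.
Hypothesis Gpos : forall x, D x -> forall u, u != 0 -> 0 < form (G x) u u.

Local Notation Gam := (Gamma G).
Local Notation lft := (@lsubmx R 1 m m).
Local Notation rgt := (@rsubmx R 1 m m).
Local Notation Rm := (curvature Gam).

Let gP := levi_civita Dop sG Gsym Gpos.
Let GamP := metric_conn gP.
Let E : set 'rV[R]_(m + m) := lft @^-1` D.

Let Eop : open E.
Proof. by apply: open_comp => // z _; exact: continuous_lsubmx. Qed.

Let Gunit x : D x -> G x \in unitmx.
Proof. by move=> Dx; exact/form_unit/Gpos. Qed.

(** Dombrowski's connection map: its kernel consists of the horizontal vectors, and it extracts the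
    vertical component of [U], the horizontal one being [lsubmx U]. *)
Definition connection_map (z U : 'rV[R]_(m + m)) : 'rV[R]_m :=
  rsubmx U + Gamma G (lsubmx z) (lsubmx U) (rsubmx z).
Local Notation K := connection_map.

Lemma lift_row z (v w : 'rV[R]_m) :
  hlift G z v + vlift z w = row_mx v (w - Gam (lsubmx z) v (rsubmx z)).
Proof. by rewrite /hlift /vlift add_row_mx addr0 addrC. Qed.

Lemma lift_decomposition z U : hlift G z (lsubmx U) + vlift z (K z U) = U.
Proof. by rewrite lift_row addrK hsubmxK. Qed.

Lemma lsubmx_lift z (v w : 'rV[R]_m) : lsubmx (hlift G z v + vlift z w) = v.
Proof. by rewrite lift_row row_mxKl. Qed.

Lemma connection_map_lift z (v w : 'rV[R]_m) : K z (hlift G z v + vlift z w) = w.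
Proof. by rewrite /K lift_row row_mxKr row_mxKl subrK. Qed.

Lemma lift_eq z U V : lsubmx U = lsubmx V -> K z U = K z V -> U = V.
Proof.
by move=> l k; rewrite -(lift_decomposition z U) l k lift_decomposition.
Qed.

Lemma form_sasaki z U V : form (sasaki G z) U V =
  form (G (lsubmx z)) (lsubmx U) (lsubmx V)
  + form (G (lsubmx z)) (K z U) (K z V).
Proof.
have L W : W = row_mx (lsubmx W) (K z W) *m lift_mx G z.
  rewrite -[in LHS](lift_decomposition z W) hliftE (vliftE G) -mulmxDl.
  by rewrite add_row_mx addr0 add0r.
rewrite [in LHS](L U) [in LHS](L V) /Defs.form /sasaki trmx_mul !mulmxA.
rewrite mulmxK ?lift_mx_unit // -!mulmxA [_^T *m (_ *m _)]mulmxA -trmx_mul.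
rewrite mulmxV ?lift_mx_unit // trmx1 mul1mx.
rewrite mulmxA mul_row_block !mulmx0 addr0 add0r tr_row_mx mul_row_col.
by rewrite !mulmxA mxE.
Qed.

Lemma sasaki_unit z : E z -> sasaki G z \in unitmx.
Proof.
move=> Ez; rewrite /sasaki !unitmx_mul unitmx_tr unitmx_inv lift_mx_unit.
by rewrite unitmxE det_ublock unitrM -!unitmxE Gunit.
Qed.

Lemma sasaki_sym z : E z -> (sasaki G z)^T = sasaki G z.
Proof.
by move=> Ez; apply: form_sym => U V; rewrite !form_sasaki; congr (_ + _); exact: Gsym.
Qed.

Lemma smooth_lsubmx : smooth E lft.
Proof. by apply: smooth_linear => z; exact: continuous_lsubmx. Qed.

Lemma smooth_rsubmx : smooth E rgt.
Proof. by apply: smooth_linear => z; exact: continuous_rsubmx. Qed.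

Lemma dd_lsubmx U z : dd U lft z = lsubmx U.
Proof. by rewrite ddE; apply: derive_linear => ?; exact: continuous_lsubmx. Qed.

Lemma dd_rsubmx U z : dd U rgt z = rsubmx U.
Proof. by rewrite ddE; apply: derive_linear => ?; exact: continuous_rsubmx. Qed.

Let fE z : E z -> D (lft z). Proof. by []. Qed.

(** TM is itself treated as a source: along the projection [lft], the fibre coordinate [rgt] is a
    field, and its covariant derivative is the connection map. Hence the pull-back calculus applies
    to the coordinates of TM. *)
Lemma pcov_rsubmx U z : pcov Gam lft U rgt z = K z U.
Proof. by rewrite pcovE dd_rsubmx dd_lsubmx. Qed.

Lemma form_sasaki_dd z U V : form (sasaki G z) U V =
  form (G (lsubmx z)) (dd U lft z) (dd V lft z)
  + form (G (lsubmx z)) (pcov Gam lft U rgt z) (pcov Gam lft V rgt z).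
Proof. by rewrite form_sasaki !pcov_rsubmx !dd_lsubmx. Qed.

Lemma smooth_sasaki : smooth E (sasaki G).
Proof.
apply: (smooth_mx Eop) => i j.
set U : 'rV[R]_(m + m) := delta_mx ord0 i; set V : 'rV[R]_(m + m) := delta_mx ord0 j.
have sf := smooth_lsubmx; have sy := smooth_rsubmx.
have S := smoothD Eop (smooth_metric_pull gP Eop fE sf (smooth_dd U sf) (smooth_dd V sf))
  (smooth_metric_pull gP Eop fE sf (smooth_pcov GamP Eop fE sf U sy) (smooth_pcov GamP Eop fE sf V sy)).
by apply: (smooth_eq Eop _ S) => z _; rewrite -form_sasaki_dd form_delta.
Qed.

Lemma dd_form_sasaki z W U V : E z ->
  dd W (fun z => form (sasaki G z) U V) z =
  form (G (lsubmx z)) (pcov Gam lft W (dd U lft) z) (dd V lft z)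
  + form (G (lsubmx z)) (dd U lft z) (pcov Gam lft W (dd V lft) z)
  + form (G (lsubmx z)) (pcov Gam lft W (pcov Gam lft U rgt) z) (pcov Gam lft V rgt z)
  + form (G (lsubmx z)) (pcov Gam lft U rgt z) (pcov Gam lft W (pcov Gam lft V rgt) z).
Proof.
move=> Ez; have sf := smooth_lsubmx; have sy := smooth_rsubmx.
have sdU := smooth_dd U sf; have sdV := smooth_dd V sf.
have skU := smooth_pcov GamP Eop fE sf U sy.
have skV := smooth_pcov GamP Eop fE sf V sy.
rewrite (dd_eq Eop W (fun y _ => form_sasaki_dd y U V) Ez).
rewrite (ddD W (smooth_metric_pull gP Eop fE sf sdU sdV)
  (smooth_metric_pull gP Eop fE sf skU skV) Ez).
rewrite (dd_metric_pull gP Eop fE sf W sdU sdV Ez).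
by rewrite (dd_metric_pull gP Eop fE sf W skU skV Ez) !addrA.
Qed.

(** A constant field [V] on TM has components [dd V lft] and [pcov Gam lft V rgt], and its covariant
    derivative along [U] is the bare Christoffel map. Both sides are compared by pairing with every
    [W], where the left one is given by the Koszul formula. *)
Lemma Gamma_sasaki z U V : E z ->
  Gamma (sasaki G) z U V =
  hlift G z (covH Gam lft rgt U (dd V lft) (pcov Gam lft V rgt) z)
  + vlift z (covV Gam lft rgt U (dd V lft) (pcov Gam lft V rgt) z).
Proof.
move=> Ez; have sf := smooth_lsubmx; have sy := smooth_rsubmx.
apply: (form_inj (sasaki_unit Ez)) => W.
rewrite (koszul Eop smooth_sasaki sasaki_sym sasaki_unit) //.
rewrite !dd_form_sasaki // form_sasaki lsubmx_lift connection_map_lift.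
rewrite -pcov_rsubmx -(dd_lsubmx W z) /covH /covV.
rewrite (pcov_torsion GamP Eop fE sf V U) //.
rewrite (pcov_torsion GamP Eop fE sf W U) //.
rewrite (pcov_torsion GamP Eop fE sf W V) //.
(* Second covariant derivatives of [rgt] are brought to one fixed order; the curvature terms of the
   connection come from these exchanges. *)
have cy p q : pcov Gam lft p (pcov Gam lft q rgt) z =
    pcov Gam lft q (pcov Gam lft p rgt) z + Rm (lft z) (dd p lft z) (dd q lft z) (rgt z).
  by rewrite -(pcov_comm GamP Eop fE sf p q sy Ez) addrC subrK.
rewrite (cy V U) (cy W U) (cy W V).
(* Pair symmetry frees the direction [W] from the inside of the curvature, so that the horizontal
   part of the Christoffel map can be read off as the vector paired with it. *)
have pair a k : form (G (lft z)) (Rm (lft z) (dd W lft z) a (rgt z)) k =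
    - form (G (lft z)) (Rm (lft z) (rgt z) k a) (dd W lft z).
  by rewrite (curvature_pair gP) // (curvature_skew gP) // (Gsym (x := lft z)).
rewrite (curvatureC Gam (lft z) (dd V lft z) (dd U lft z)).
rewrite !(metric_lin gP) !(Gsym Ez (pcov Gam lft U rgt z)) !pair.
rewrite (Gsym Ez (dd V lft z)) (Gsym Ez (pcov Gam lft V rgt z) (pcov _ _ _ _ _)).
lra.
Qed.

Lemma connection_mapD z U V : K z (U + V) = K z U + K z V.
Proof. by rewrite /K !linearD /= (GamDl GamP) addrACA. Qed.

Lemma dd_connection_map z U V : E z ->
  pcov Gam lft U (pcov Gam lft V rgt) z =
  dd (lsubmx U) (fun x => Gam x (lsubmx V) (rsubmx z)) (lsubmx z)
  + Gam (lsubmx z) (lsubmx V) (rsubmx U) + Gam (lsubmx z) (lsubmx U) (K z V).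
Proof.
move=> Ez; have sf := smooth_lsubmx; have sy := smooth_rsubmx.
have sc (c : 'rV[R]_m) : smooth E (fun=> c) by exact: smooth_cst.
have -> : pcov Gam lft V rgt =
    (fun z => rsubmx V + Gam (lsubmx z) (lsubmx V) (rsubmx z)).
  by apply/funext => x; rewrite pcov_rsubmx.
rewrite pcovE (ddD U (sc _) (smooth_Gam_pull GamP Eop fE sf (sc _) sy) Ez).
rewrite (dd_Gam_pull GamP Eop fE sf U (sc _) sy Ez) !dd_cst add0r.
rewrite dd_lsubmx dd_rsubmx (linear_prop0 (Gam_linearl GamP _ _)) addr0.
by [].
Qed.

Section Sections.
Context {U : normedModType R} (E' : set U) (E'op : open E').
Variable F : U -> 'rV[R]_(m + m).
Hypothesis FE : forall x, E' x -> E (F x).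
Hypothesis sF : smooth E' F.
Variables a b : U -> 'rV[R]_m.
Hypotheses (sa : smooth E' a) (sb : smooth E' b).
Let f x := lft (F x).
Let y x := rgt (F x).

Lemma smooth_lsubmx_comp : smooth E' f.
Proof.
by apply: (smooth_comp_linear (l := lft)) => // z; exact: continuous_lsubmx.
Qed.

Lemma smooth_rsubmx_comp : smooth E' y.
Proof.
by apply: (smooth_comp_linear (l := rgt)) => // z; exact: continuous_rsubmx.
Qed.

Lemma lsubmx_dd (V : U -> 'rV[R]_(m + m)) w x : smooth E' V -> E' x ->
  lsubmx (dd w V x) = dd w (fun x => lsubmx (V x)) x.
Proof.
move=> sV Ex; have dV := smooth_differentiable sV Ex.
have lc : continuous lft by move=> z; exact: continuous_lsubmx.
by have := derive_comp_linear (l := lft) w lc dV; rewrite -!ddE => <-.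
Qed.

Lemma rsubmx_dd (V : U -> 'rV[R]_(m + m)) w x : smooth E' V -> E' x ->
  rsubmx (dd w V x) = dd w (fun x => rsubmx (V x)) x.
Proof.
move=> sV Ex; have dV := smooth_differentiable sV Ex.
have lc : continuous rgt by move=> z; exact: continuous_rsubmx.
by have := derive_comp_linear (l := rgt) w lc dV; rewrite -!ddE => <-.
Qed.

Definition lift_section x := hlift G (F x) (a x) + vlift (F x) (b x).

Lemma smooth_lift_section : smooth E' lift_section.
Proof.
have sf := smooth_lsubmx_comp; have sy := smooth_rsubmx_comp.
apply: (smooth_mx E'op) => i j; rewrite ord1.
have s1 : smooth E' (fun x => b x - Gam (f x) (a x) (y x)).
  apply: (smoothB E'op) => //.
  by apply: (smooth_Gam_pull GamP E'op FE).
have [k|k] := split_ordP j; move=> ->.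
  apply: (smooth_eq E'op _ (smooth_entry ord0 k E'op sa)) => x _.
  by rewrite /lift_section lift_row row_mxEl.
apply: (smooth_eq E'op _ (smooth_entry ord0 k E'op s1)) => x _.
by rewrite /lift_section lift_row row_mxEr.
Qed.

(** The Christoffel map is known from constant fields; letting the components vary along [F] only
    adds their ordinary derivatives. A vector of TM being determined by its base part and its image
    under the connection map, the two are checked separately. *)
Lemma dd_lift_section w x : E' x ->
  dd w lift_section x + Gamma (sasaki G) (F x) (dd w F x) (lift_section x) =
  hlift G (F x) (covH Gam f y w a b x) + vlift (F x) (covV Gam f y w a b x).
Proof.
move=> Ex; have sf := smooth_lsubmx_comp; have sy := smooth_rsubmx_comp.
have sV := smooth_lift_section.
have l_cst V : pcov Gam lft (dd w F x) (dd V lft) (F x) =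
    Gam (f x) (dd w f x) (lsubmx V).
  rewrite pcovE dd_lsubmx.
  have -> : dd V lft = (fun=> lsubmx V) by apply/funext => z; exact: dd_lsubmx.
  by rewrite dd_cst add0r (lsubmx_dd w sF Ex).
have lV : (fun x => lsubmx (lift_section x)) = a.
  by apply/funext => t; rewrite lsubmx_lift.
have rV : (fun x => rsubmx (lift_section x)) = (fun x => b x - Gam (f x) (a x) (y x)).
  by apply/funext => t; rewrite /lift_section lift_row row_mxKr.
have kF : K (F x) (dd w F x) = pcov Gam f w y x.
  by rewrite pcovE /K (lsubmx_dd w sF Ex) (rsubmx_dd w sF Ex).
rewrite (Gamma_sasaki _ _ (FE Ex)); apply: (@lift_eq (F x)).
  rewrite [LHS]linearD /= !lsubmx_lift (lsubmx_dd w sV Ex) lV /covH l_cst.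
  rewrite !pcov_rsubmx connection_map_lift kF !dd_lsubmx !lsubmx_lift.
  by rewrite (lsubmx_dd w sF Ex) !pcovE addrA.
rewrite [LHS]connection_mapD !connection_map_lift /covV (dd_connection_map _ _ (FE Ex)).
rewrite !dd_lsubmx connection_map_lift !lsubmx_lift.
rewrite /K (lsubmx_dd w sV Ex) (rsubmx_dd w sV Ex) lV rV.
rewrite (lsubmx_dd w sF Ex) (rsubmx_dd w sF Ex).
rewrite (ddB E'op w sb (smooth_Gam_pull GamP E'op FE sf sa sy) Ex).
rewrite (dd_Gam_pull GamP E'op FE sf w sa sy Ex) pcovE -/(f x) -/(y x).
row_lra.
Qed.

End Sections.
End Sasaki.

(** * Covariant derivatives and curvature of vector fields *)

Lemma nablaE {R : realType} {n : nat} (H : 'rV[R]_n -> 'M[R]_n) Y Z :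
  nabla H Y Z = fun x => pcov (Gamma H) id (Y x) Z x.
Proof. by apply/funext => x; rewrite pcovE dd_id ddE. Qed.

Section PcovEq.
Context {R : realType} {m : nat} (D : set 'rV[R]_m).
Variable Gam : 'rV[R]_m -> 'rV[R]_m -> 'rV[R]_m -> 'rV[R]_m.
Hypothesis GamP : connection D Gam.
Implicit Types (x u v w : 'rV[R]_m) (A B X Y Z : 'rV[R]_m -> 'rV[R]_m).

Let Dop := connection_open GamP.
Let sid : smooth D (@id 'rV[R]_m) := smooth_id D.
Local Notation cov := (pcov Gam id).
Local Notation Rm := (curvature Gam).

Lemma pcov_idE w Z x : cov w Z x = dd w Z x + Gam x w (Z x).
Proof. by rewrite pcovE dd_id. Qed.

Lemma pcov_eq w A B x : (forall y, D y -> A y = B y) -> D x ->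
  cov w A x = cov w B x.
Proof.
by move=> AB Dx; rewrite !pcov_idE (dd_eq Dop w AB Dx) (AB x Dx).
Qed.

Lemma pcovN w A x : smooth D A -> D x -> cov w (fun y => - A y) x = - cov w A x.
Proof.
by move=> sA Dx; rewrite !pcov_idE (ddN w sA Dx) (GamNr GamP) opprD.
Qed.

Lemma pcov_linear A x : smooth D A -> D x -> linear (fun w => cov w A x).
Proof.
move=> sA Dx c u v; rewrite !pcov_idE (dd_linear sA Dx) (Gam_lin GamP).
rewrite (GamZl GamP); row_lra.
Qed.

Lemma smooth_nabla Y Z : smooth D Y -> smooth D Z ->
  smooth D (fun x => cov (Y x) Z x).
Proof.
move=> sY sZ; apply: (smooth_lin Dop (L := fun x w => cov w Z x)) => // [x Dx|w].
  exact: pcov_linear.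
exact: (smooth_pcov GamP Dop (fun y Dy => Dy) sid).
Qed.

(** [pcov] takes a frozen direction while [nabla] follows a field; the last term accounts for the
    variation of that direction. *)
Lemma pcov_nabla w Y Z x : smooth D Y -> smooth D Z -> D x ->
  cov w (fun y => cov (Y y) Z y) x =
  cov w (cov (Y x) Z) x + cov (dd w Y x) Z x.
Proof.
move=> sY sZ Dx; rewrite !(pcov_idE w).
have -> : dd w (fun y => cov (Y y) Z y) x =
    dd w (cov (Y x) Z) x + cov (dd w Y x) Z x.
  apply: (dd_lin Dop (L := fun x w => cov w Z x)) => // [y Dy|v].
    exact: pcov_linear.
  exact: (smooth_pcov GamP Dop (fun y Dy => Dy) sid).
row_lra.
Qed.

End PcovEq.

Section FieldCurvature.
Context {R : realType} {m : nat} (D : set 'rV[R]_m).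
Variable G : 'rV[R]_m -> 'M[R]_m.
Local Notation Gam := (Gamma G).
Hypothesis GamP : connection D Gam.
Implicit Types (x u v w : 'rV[R]_m) (X Y Z W : 'rV[R]_m -> 'rV[R]_m).

Let Dop := connection_open GamP.
Let sid : smooth D (@id 'rV[R]_m) := smooth_id D.
Local Notation cov := (pcov Gam id).
Local Notation Rm := (curvature Gam).

(** Tensoriality: the terms that differentiate [X] and [Y] as directions add up to the derivative of
    [Z] along the bracket, which [curv] subtracts. The commutator for frozen directions remains. *)
Lemma curvE X Y Z x : smooth D X -> smooth D Y -> smooth D Z -> D x ->
  curv G X Y Z x = Rm x (X x) (Y x) (Z x).
Proof.
move=> sX sY sZ Dx; rewrite /curv !nablaE /bracket -!ddE.
have -> : cov (dd (X x) Y x - dd (Y x) X x) Z x =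
    cov (dd (X x) Y x) Z x - cov (dd (Y x) X x) Z x.
  exact: (linear_propB (pcov_linear GamP sZ Dx)).
rewrite (pcov_nabla GamP (X x) sY sZ Dx) (pcov_nabla GamP (Y x) sX sZ Dx).
have := pcov_comm GamP Dop (fun y Dy => Dy) sid (X x) (Y x) sZ Dx.
rewrite !dd_id => <-; row_lra.
Qed.

Lemma nabla_curvE W X Y Z x :
  smooth D W -> smooth D X -> smooth D Y -> smooth D Z -> D x ->
  nabla_curv G W X Y Z x = dcurvature Gam x (W x) (X x) (Y x) (Z x).
Proof.
move=> sW sX sY sZ Dx; rewrite /nabla_curv !nablaE.
have sN T : smooth D T -> smooth D (fun x => cov (W x) T x).
  exact: (smooth_nabla GamP).
rewrite (curvE (sN _ sX)) // (curvE sX (sN _ sY)) // (curvE sX sY (sN _ sZ)) //.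
have -> : cov (W x) (curv G X Y Z) x =
    cov (W x) (fun y => Rm y (X y) (Y y) (Z y)) x.
  by apply: (pcov_eq GamP) => // y Dy; exact: curvE.
rewrite (pcov_curvature GamP Dop (fun y Dy => Dy) sid _ sX sY sZ Dx) dd_id.
row_lra.
Qed.

End FieldCurvature.

(** * Curvature of the Sasaki metric *)

Section SasakiCurvature.
Context {R : realType} {m : nat} (D : set 'rV[R]_m) (Dop : open D).
Variable G : 'rV[R]_m -> 'M[R]_m.
Hypothesis sG : smooth D G.
Hypothesis Gsym : forall x, D x -> forall u v, form (G x) u v = form (G x) v u.
Hypothesis Gpos : forall x, D x -> forall u, u != 0 -> 0 < form (G x) u u.

Local Notation Gam := (Gamma G).
Local Notation lft := (@lsubmx R 1 m m).
Local Notation rgt := (@rsubmx R 1 m m).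
Local Notation Rm := (curvature Gam).
Local Notation nR := (dcurvature Gam).
Local Notation K := (connection_map G).

Let gP := levi_civita Dop sG Gsym Gpos.
Let GamP := metric_conn gP.
Let E : set 'rV[R]_(m + m) := lft @^-1` D.

Let Eop : open E.
Proof. by apply: open_comp => // z _; exact: continuous_lsubmx. Qed.

Lemma lift_sub z (v w v' w' : 'rV[R]_m) :
  (hlift G z v + vlift z w) - (hlift G z v' + vlift z w') =
  hlift G z (v - v') + vlift z (w - w').
Proof.
rewrite !lift_row opp_row_mx add_row_mx (GamDl GamP) (GamNl GamP).
congr row_mx; row_lra.
Qed.

Lemma lift_add z (v w v' w' : 'rV[R]_m) :
  (hlift G z v + vlift z w) + (hlift G z v' + vlift z w') =
  hlift G z (v + v') + vlift z (w + w').
Proof.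
rewrite !lift_row add_row_mx (GamDl GamP).
congr row_mx; row_lra.
Qed.

(** Kowalski's curvature formulas, for all combinations of horizontal and vertical arguments at
    once. *)
Lemma curv_at_sasaki z U V W : D (lft z) ->
  let x := lft z in let p := rgt z in
  let u := lft U in let v := lft V in let w := lft W in
  let ku := K z U in let kv := K z V in let kw := K z W in
  curv_at (sasaki G) z U V W =
  hlift G z (Rm x u v w + Rm x ku kv w
  + 2^-1 *: (nR x u p kw v - nR x v p kw u + nR x u p kv w - nR x v p ku w
             + Rm x ku kw v - Rm x kv kw u + Rm x p (Rm x u v p) w)
  + 4^-1 *: (Rm x p (Rm x u w p) v - Rm x p (Rm x v w p) u
             + Rm x p ku (Rm x p kw v + Rm x p kv w)
             - Rm x p kv (Rm x p kw u + Rm x p ku w)))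
  + vlift z (Rm x u v kw
  - 2^-1 *: (nR x u v w p - nR x v u w p + Rm x v w ku - Rm x u w kv)
  - 4^-1 *: (Rm x u (Rm x p kw v + Rm x p kv w) p
             - Rm x v (Rm x p kw u + Rm x p ku w) p)).
Proof.
move=> Dz /=; have Ez : E z by [].
have sf : smooth E lft := @smooth_lsubmx R m D.
have sy : smooth E rgt := @smooth_rsubmx R m D.
have fE y : E y -> D (lft y) by [].
pose a : 'rV[R]_(m + m) -> 'rV[R]_m := fun=> lsubmx W.
pose b y := K y W.
have sa : smooth E a by exact: smooth_cst.
have sb : smooth E b.
  have -> : b = pcov Gam lft W rgt by apply/funext => y; rewrite pcov_rsubmx.
  exact: (smooth_pcov GamP Eop fE sf).
(* Differentiating a field given by two components on [E] yields a field of the same kind, so the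
   formula can be applied a second time to its own result. *)
have N T (c d : 'rV[R]_(m + m) -> 'rV[R]_m) (Z : 'rV[R]_(m + m) -> 'rV[R]_(m + m)) y :
    smooth E c -> smooth E d ->
    (forall y, E y -> Z y = hlift G y (c y) + vlift y (d y)) -> E y ->
    nabla (sasaki G) (fun=> T) Z y =
    hlift G y (covH Gam lft rgt T c d y) + vlift y (covV Gam lft rgt T c d y).
  move=> sc sd ZE Ey.
  have := dd_lift_section Dop sG Gsym Gpos Eop (F := id) (fun y Ey => Ey)
    (smooth_id E) sc sd T Ey.
  rewrite dd_id => <-; rewrite nablaE pcov_idE (dd_eq Eop T ZE Ey) (ZE y Ey).
  by [].
have NW T y : E y -> nabla (sasaki G) (fun=> T) (fun=> W) y =
    hlift G y (covH Gam lft rgt T a b y) + vlift y (covV Gam lft rgt T a b y).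
  by move=> Ey; apply: N => // y' _; rewrite lift_decomposition.
have sH T := smooth_covH GamP Eop fE sf sy T sa sb.
have sV T := smooth_covV GamP Eop fE sf sy T sa sb.
rewrite /curv_at /curv (N U _ _ _ z (sH V) (sV V) (NW V) Ez).
rewrite (N V _ _ _ z (sH U) (sV U) (NW U) Ez) lift_sub.
rewrite (split_commH GamP Eop fE sf sy U V sa sb Ez).
rewrite (split_commV GamP Eop fE sf sy U V sa sb Ez).
(* The arguments are extended with constant components, so their bracket is zero. *)
have -> : nabla (sasaki G) (bracket (fun=> U) (fun=> V)) (fun=> W) z = 0.
  rewrite /nabla /bracket !derive_cst subrr add0r.
  exact: (linear_prop0 (Gamma_linearl _ _ _)).
by rewrite subr0 !dd_lsubmx !pcov_rsubmx.
Qed.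

End SasakiCurvature.

(** * Tension and bitension fields *)

Section Bitension.
Context {R : realType} {m : nat} (D : set 'rV[R]_m) (Dop : open D).
Variable G : 'rV[R]_m -> 'M[R]_m.
Hypothesis sG : smooth D G.
Hypothesis Gsym : forall x, D x -> forall u v,
  form (G x) u v = form (G x) v u.
Hypothesis Gpos : forall x, D x -> forall u, u != 0 -> 0 < form (G x) u u.
Variables (Y : 'rV[R]_m -> 'rV[R]_m) (F : 'rV[R]_m -> 'rV[R]_(m + m)).
Hypothesis sY : smooth D Y.
Hypothesis FE : forall x, D x -> F x = row_mx x (Y x).

Local Notation Gam := (Gamma G).
Local Notation lft := (@lsubmx R 1 m m).
Local Notation rgt := (@rsubmx R 1 m m).
Local Notation Rm := (curvature Gam).
Local Notation nR := (dcurvature Gam).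
Local Notation H := (sasaki G).
Local Notation cov := (pcov Gam id).
Local Notation Z0 := (fun x => row_mx x (Y x)).
Local Notation lift z a b := (hlift G z a + vlift z b).

Let GamP := metric_conn (levi_civita Dop sG Gsym Gpos).
Let sid : smooth D (@id 'rV[R]_m) := smooth_id D.

(** [F] is prescribed on [D] only. [Z0] is the corresponding graph on the whole space: its two
    halves are [id] and [Y] as functions, which allows rewriting with [lZ0] and [rZ0] without a
    domain condition. *)
Let sZ0 : smooth D Z0.
Proof.
apply: (smooth_mx Dop) => i j; rewrite ord1.
have [k|k] := split_ordP j; move=> ->.
  by apply: (smooth_eq Dop _ (smooth_entry ord0 k Dop sid)) => x _; rewrite row_mxEl.
by apply: (smooth_eq Dop _ (smooth_entry ord0 k Dop sY)) => x _; rewrite row_mxEr.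
Qed.

Let lZ0 : (fun x => lft (row_mx x (Y x))) = id.
Proof. by apply/funext => x; rewrite row_mxKl. Qed.

Let rZ0 : (fun x => rgt (row_mx x (Y x))) = Y.
Proof. by apply/funext => x; rewrite row_mxKr. Qed.

Lemma pnabla_lift (V : 'rV[R]_m -> 'rV[R]_(m + m)) a b e x :
  smooth D a -> smooth D b ->
  (forall y, D y -> V y = lift (row_mx y (Y y)) (a y) (b y)) -> D x ->
  pnabla H F e V x = lift (row_mx x (Y x)) (covH Gam id Y (e x) a b x)
                                           (covV Gam id Y (e x) a b x).
Proof.
move=> sa sb VE Dx.
have Z0E y : D y -> D (lft (row_mx y (Y y))) by rewrite row_mxKl.
have := dd_lift_section Dop sG Gsym Gpos Dop (F := Z0) Z0E sZ0 sa sb (e x) Dx.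
rewrite lZ0 rZ0 => <-; rewrite /pnabla /dmap -!ddE.
by rewrite (dd_eq Dop _ VE Dx) (dd_eq Dop _ FE Dx) (FE Dx) (VE x Dx).
Qed.

Lemma dmap_lift e x : D x ->
  dmap F e x = lift (row_mx x (Y x)) (e x) (cov (e x) Y x).
Proof.
move=> Dx; rewrite /dmap -ddE (dd_eq Dop _ FE Dx) lift_row row_mxKl row_mxKr.
rewrite pcov_idE addrK -[LHS]hsubmxK (lsubmx_dd _ sZ0 Dx) (rsubmx_dd _ sZ0 Dx).
by rewrite lZ0 rZ0 dd_id.
Qed.

(** This is minus one summand of the bitension field, with arbitrary components [a] and [b] in place
    of those of the tension field. The terms with factor 1/2 are those that simplify only after
    summation over the frame. *)
Lemma bitension_summand (V : 'rV[R]_m -> 'rV[R]_(m + m)) a b e x :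
  smooth D a -> smooth D b -> smooth D e ->
  (forall y, D y -> V y = lift (row_mx y (Y y)) (a y) (b y)) -> D x ->
  let p := Y x in
  let k := cov (e x) Y x in
  let Lap Z := cov (cov (e x) e x) Z x - cov (e x) (fun y => cov (e y) Z y) x in
  pnabla H F e (pnabla H F e V) x - pnabla H F (nabla G e e) V x
  + curv_at H (F x) (V x) (dmap F e x) (dmap F e x) =
  lift (row_mx x p)
    (- (Lap a - Rm x p (cov (e x) b x) (e x) - Rm x p k (cov (e x) a x)
        - nR x (a x) p k (e x) - Rm x (b x) k (e x) + Rm x (e x) (a x) (e x)
        + Rm x p (Rm x (e x) (a x) p) (e x)
        + 2^-1 *: (Rm x p (Lap Y) (a x) - Rm x p (b x) (Rm x p k (e x)))))
    (- (Lap b + nR x (e x) (e x) (a x) p + Rm x (e x) (cov (e x) a x) p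
        + 2 *: Rm x (e x) (a x) k - 2^-1 *: Rm x (Rm x p k (e x)) (a x) p)).
Proof.
move=> sa sb se VE Dx p k Lap.
have DE y : D y -> D (id y) by [].
have sN := smooth_nabla GamP se.
have sR := smooth_curvature_pull GamP Dop DE sid.
(* The direction [e y] now moves with the point, so [pcov_covH] and [pcov_covV], stated for constant
   directions, do not apply. The Leibniz rule is carried out again on these components. *)
pose a1 y := covH Gam id Y (e y) a b y.
pose b1 y := covV Gam id Y (e y) a b y.
have a1E : a1 = fun y => cov (e y) a y
    + 2^-1 *: (Rm y (Y y) (b y) (e y) + Rm y (Y y) (cov (e y) Y y) (a y)).
  by apply/funext => y; rewrite /a1 /covH dd_id.
have b1E : b1 = fun y => cov (e y) b y - 2^-1 *: Rm y (e y) (a y) (Y y).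
  by apply/funext => y; rewrite /b1 /covV dd_id.
have s1 := sR _ _ _ sY sb se.
have s2 := sR _ _ _ sY (sN _ sY) sa.
have s3 := sR _ _ _ se sa sY.
have sa1 : smooth D a1.
  rewrite a1E; apply: (smoothD Dop); first exact: sN.
  by apply: (smoothZ Dop); exact: (smoothD Dop).
have sb1 : smooth D b1.
  by rewrite b1E; apply: (smoothB Dop); [exact: sN|exact: (smoothZ Dop)].
have ca1 : cov (e x) a1 x = cov (e x) (fun y => cov (e y) a y) x + 2^-1 *: (
    nR x (e x) p (b x) (e x) + Rm x k (b x) (e x) + Rm x p (cov (e x) b x) (e x)
    + Rm x p (b x) (cov (e x) e x)
    + (nR x (e x) p k (a x) + Rm x k k (a x)
       + Rm x p (cov (e x) (fun y => cov (e y) Y y) x) (a x)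
       + Rm x p k (cov (e x) a x))).
  rewrite a1E (pcovD GamP _ _ (sN _ sa) (smoothZ Dop _ (smoothD Dop s1 s2)) Dx).
  rewrite (pcovZ GamP _ _ _ (smoothD Dop s1 s2) Dx) (pcovD GamP _ _ s1 s2 Dx).
  rewrite (pcov_curvature GamP Dop DE sid _ sY sb se Dx).
  by rewrite (pcov_curvature GamP Dop DE sid _ sY (sN _ sY) sa Dx) dd_id.
have cb1 : cov (e x) b1 x = cov (e x) (fun y => cov (e y) b y) x - 2^-1 *: (
    nR x (e x) (e x) (a x) p + Rm x (cov (e x) e x) (a x) p
    + Rm x (e x) (cov (e x) a x) p + Rm x (e x) (a x) k).
  have -> : b1 = fun y => cov (e y) b y + (- 2^-1) *: Rm y (e y) (a y) (Y y).
    by rewrite b1E; apply/funext => y; rewrite scaleNr.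
  rewrite (pcovD GamP _ _ (sN _ sb) (smoothZ Dop _ s3) Dx).
  rewrite (pcovZ GamP _ _ _ s3 Dx) scaleNr.
  by rewrite (pcov_curvature GamP Dop DE sid _ se sa sY Dx) dd_id.
have V1 y : D y -> pnabla H F e V y = lift (row_mx y (Y y)) (a1 y) (b1 y).
  by move=> Dy; rewrite (pnabla_lift e sa sb VE Dy).
rewrite (pnabla_lift e sa1 sb1 V1 Dx) (pnabla_lift _ sa sb VE Dx).
have Dz : D (lft (row_mx x (Y x))) by rewrite row_mxKl.
rewrite (FE Dx) (VE x Dx) (dmap_lift e Dx) (curv_at_sasaki Dop sG Gsym Gpos) //.
rewrite !lsubmx_lift !connection_map_lift row_mxKl row_mxKr nablaE.
rewrite (lift_sub Dop sG Gsym Gpos) (lift_add Dop sG Gsym Gpos).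
rewrite /covH /covV !dd_id ca1 cb1 (congr1 (fun f => f x) a1E) (congr1 (fun f => f x) b1E).
rewrite -/p -/k !(curvature_id Gam) !(curvatureC Gam x (a x) (e x)).
rewrite (curvatureC Gam x k (b x)) (curvatureC Gam x (Rm x p k (e x)) (a x)).
rewrite (dcurvatureC GamP _ (a x) (e x)) // !(dcurvature_id GamP) //.
rewrite (linear_prop0 (curvature_linear2 GamP p (a x) Dx)).
rewrite /Lap !(curvature_lin GamP) //.
congr (hlift G _ _ + vlift _ _); row_lra.
Qed.

Lemma hlift_linear z : linear (hlift G z).
Proof.
move=> c u v; rewrite /hlift (Gam_lin GamP) (GamZl GamP) scale_row_mx add_row_mx.
congr row_mx; row_lra.
Qed.

Lemma vlift_linear (z : 'rV[R]_(m + m)) : linear (@vlift R m z).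
Proof. by move=> c u v; rewrite /vlift scale_row_mx add_row_mx scaler0 addr0. Qed.

Lemma lift_sum (I : Type) (r : seq I) (P : pred I) z (a b : I -> 'rV[R]_m) :
  \sum_(i <- r | P i) lift z (a i) (b i) =
  lift z (\sum_(i <- r | P i) a i) (\sum_(i <- r | P i) b i).
Proof.
by rewrite big_split /= (linear_prop_sum (hlift_linear z)) (linear_prop_sum (vlift_linear z)).
Qed.

Lemma lift_combination z (c c' : R) (a b a' b' : 'rV[R]_m) :
  c *: lift z a b + c' *: lift z a' b' =
  lift z (c *: a + c' *: a') (c *: b + c' *: b').
Proof.
rewrite (linear_propD (hlift_linear z)) (linear_propD (vlift_linear z)).
rewrite !(linear_propZ (hlift_linear z)) !(linear_propZ (vlift_linear z)).
by rewrite !scalerDr addrACA.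
Qed.

Variable e : 'I_m -> 'rV[R]_m -> 'rV[R]_m.
Hypothesis se : forall i, smooth D (e i).
Local Notation S := (S_field G e Y).
Local Notation Lap := (rough_laplacian G e).

Let Lap_i i Z x :=
  cov (cov (e i x) (e i) x) Z x - cov (e i x) (fun y => cov (e i y) Z y) x.

Let sN i Z : smooth D Z -> smooth D (fun x => cov (e i x) Z x).
Proof. exact: (smooth_nabla GamP (se i)). Qed.

Lemma rough_laplacianE Z x : Lap Z x = \sum_i Lap_i i Z x.
Proof. by apply: eq_bigr => i _; rewrite !nablaE. Qed.

Lemma S_fieldE x : D x ->
  S x = \sum_i Rm x (cov (e i x) Y x) (Y x) (e i x).
Proof.
move=> Dx; apply: eq_bigr => i _; rewrite nablaE (curvE GamP) //; exact: sN.
Qed.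

Lemma smooth_rough_laplacian Z : smooth D Z -> smooth D (Lap Z).
Proof.
move=> sZ; have T : smooth D (fun x => \sum_i Lap_i i Z x).
  apply: (smooth_sum Dop) => i; apply: (smoothB Dop); last by apply: sN; exact: sN.
  by apply: (smooth_nabla GamP) => //; exact: sN.
by apply: (smooth_eq Dop _ T) => x _; rewrite rough_laplacianE.
Qed.

Lemma smooth_S_field : smooth D S.
Proof.
have T : smooth D (fun x => \sum_i Rm x (cov (e i x) Y x) (Y x) (e i x)).
  apply: (smooth_sum Dop) => i.
  by apply: (smooth_curvature_pull GamP Dop (fun x Dx => Dx) sid) => //; exact: sN.
by apply: (smooth_eq Dop _ T) => x Dx; rewrite S_fieldE.
Qed.

(** For [a] = e_i and [b] = nabla_(e_i) X the two halves in [covH] coincide and give one full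
    curvature term, while the correction in [covV] is R(e_i, e_i) X = 0. *)
Lemma tension_lift x : D x ->
  tension G H e F x = lift (row_mx x (Y x)) (- S x) (- Lap Y x).
Proof.
move=> Dx; rewrite (S_fieldE Dx) rough_laplacianE -!sumrN -lift_sum.
apply: eq_bigr => i _.
rewrite (pnabla_lift (e i) (se i) (sN i sY) (dmap_lift (e i)) Dx).
rewrite (dmap_lift _ Dx) (lift_sub Dop sG Gsym Gpos) nablaE.
rewrite /covH /covV /Lap_i !dd_id (curvature_id Gam).
rewrite (curvatureC Gam x (Y x)); congr (hlift G _ _ + vlift _ _); row_lra.
Qed.

Let pcovN' w Z x : smooth D Z -> D x ->
  cov w (fun y => - Z y) x = - cov w Z x.
Proof. exact: (pcovN GamP). Qed.

Let Lap_iN i Z x : smooth D Z -> D x -> Lap_i i (fun y => - Z y) x = - Lap_i i Z x.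
Proof.
move=> sZ Dx; rewrite /Lap_i (pcovN' _ sZ Dx).
have -> : cov (e i x) (fun y => cov (e i y) (fun y => - Z y) y) x =
    - cov (e i x) (fun y => cov (e i y) Z y) x.
  rewrite -(pcovN' _ (sN i sZ) Dx).
  by apply: (pcov_eq GamP) => // y Dy; exact: pcovN'.
row_lra.
Qed.

Lemma bitension_lift x : D x ->
  let p := Y x in
  bitension G H e F x = lift (row_mx x p)
    (- Lap S x - Rm x p (Lap Y x) (S x)
     + \sum_i (Rm x p (cov (e i x) (Lap Y) x) (e i x)
               - Rm x (cov (e i x) Y x) (Lap Y x) (e i x)
               - Rm x (e i x) (S x) (e i x)
               - nR x (S x) (cov (e i x) Y x) p (e i x)
               + Rm x p (cov (e i x) Y x) (cov (e i x) S x)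
               - Rm x p (Rm x (e i x) (S x) p) (e i x)))
    (- Lap (Lap Y) x
     - \sum_i (nR x (e i x) (e i x) (S x) p + Rm x (e i x) (cov (e i x) S x) p
               + 2 *: Rm x (e i x) (S x) (cov (e i x) Y x))).
Proof.
move=> Dx p; have sS := smooth_S_field; have sL := smooth_rough_laplacian sY.
have sNS := smoothN Dop sS; have sNL := smoothN Dop sL.
have E i := bitension_summand sNS sNL (se i) tension_lift Dx.
rewrite /bitension /pull_laplacian -opprD -big_split /=.
under eq_bigr => i _ do rewrite E.
rewrite lift_sum !sumrN -/p.
rewrite opprD -(linear_propN (hlift_linear _)) -(linear_propN (vlift_linear _)).
rewrite !opprK (rough_laplacianE S) (rough_laplacianE (Lap Y)).
have SE : \sum_i Rm x p (cov (e i x) Y x) (e i x) = - S x.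
  by rewrite (S_fieldE Dx) -sumrN; apply: eq_bigr => i _; rewrite curvatureC.
have LE : Lap Y x = \sum_i Lap_i i Y x by exact: rough_laplacianE.
have LNS i := Lap_iN i sS Dx.
have LNL i := Lap_iN i sL Dx.
(* Generalized, since sumrN would otherwise unfold them into sums. *)
move: (S) (Lap Y) SE LE sS sL LNS LNL {sNS sNL E} => T L SE LE sT sL LNT LNL.
have {}LNT i : cov (cov (e i x) (e i) x) (fun y => - T y) x
    - cov (e i x) (fun y => cov (e i y) (fun y => - T y) y) x = - Lap_i i T x.
  exact: LNT.
have {}LNL i : cov (cov (e i x) (e i) x) (fun y => - L y) x
    - cov (e i x) (fun y => cov (e i y) (fun y => - L y) y) x = - Lap_i i L x.
  exact: LNL.
congr (hlift G _ _ + vlift _ _).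
  (* Two half terms do not match index by index. Summed, one gives half of - R(p, L) T because the
     [Lap_i] add up to [L], the other gives the same half because of [SE]; together they form the
     single term - R(p, L) T. Hence this term is split into halves, to be expanded by [R1] and [R2]
     respectively. *)
  have R1 : Rm x p (L x) (T x) = \sum_i Rm x p (Lap_i i Y x) (T x).
    by rewrite LE (linear_prop_sum (curvature_linear2 GamP p (T x) Dx)).
  have R2 : - Rm x p (L x) (T x) =
      \sum_i Rm x p (L x) (Rm x p (cov (e i x) Y x) (e i x)).
    by rewrite -(linear_prop_sum (curvature_linear3 GamP p (L x) Dx)) SE
      (curvatureNr GamP).
  have -> : - \sum_i Lap_i i T x - Rm x p (L x) (T x) =
      - \sum_i Lap_i i T x - 2^-1 *: Rm x p (L x) (T x)
      + 2^-1 *: (- Rm x p (L x) (T x)) by row_lra.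
  rewrite R2 R1 !scaler_sumr -!sumrN -!big_split /=; apply: eq_bigr => i _.
  rewrite (LNT i) (pcovN' _ sT Dx) (pcovN' _ sL Dx) -/(Lap_i i Y x).
  rewrite (dcurvatureN1 GamP) // !(curvature_lin GamP) //.
  rewrite (curvatureC Gam x (L x) (cov (e i x) Y x)).
  rewrite (dcurvatureC GamP _ p) //.
  row_lra.
(* The vertical half term sums to R(- T, T) p, where [T] stands for S(X), and so disappears. *)
have W0 : \sum_i Rm x (Rm x p (cov (e i x) Y x) (e i x)) (T x) p = 0.
  rewrite -(linear_prop_sum (curvature_linear1 GamP (T x) p Dx)) SE.
  by rewrite (curvatureNl GamP) // curvature_id oppr0.
transitivity (- \sum_i Lap_i i L x
    - \sum_i (nR x (e i x) (e i x) (T x) p + Rm x (e i x) (cov (e i x) T x) p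
               + 2 *: Rm x (e i x) (T x) (cov (e i x) Y x))
    + 2^-1 *: \sum_i Rm x (Rm x p (cov (e i x) Y x) (e i x)) (T x) p).
  rewrite scaler_sumr -!sumrN -!big_split /=; apply: eq_bigr => i _.
  rewrite (LNL i) (pcovN' _ sT Dx) (dcurvatureN3 GamP) // !(curvature_lin GamP) //.
  row_lra.
by rewrite W0 scaler0 addr0.
Qed.

End Bitension.

(** * From the manifold to a chart *)

Lemma smooth_on_subset (R : realType) n (V : normedModType R)
    (D D' : set 'rV[R]_n) (f : 'rV[R]_n -> V) :
  D' `<=` D -> smooth_on D f -> smooth_on D' f.
Proof.
move=> D'D sf k; move: (sf k) => {sf}; elim: k f => [|k IH] f [cf df].
  by split=> // x /D'D; exact: cf.
split=> [x /D'D|a]; first exact: cf.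
have [dfa Df] := df a; split=> [x /D'D|]; first exact: dfa.
exact: IH.
Qed.

Section Charts.
Context {R : realType} {m : nat} (M : manifold R m).
Implicit Types (i : chart_index M) (p : M).

Lemma chart_mapK i p : chart_dom i p -> chart_inv i (chart_map i p) = p.
Proof. by case: M i p. Qed.

Lemma open_chart_image i : open (chart_map i @` chart_dom i).
Proof. by case: M i. Qed.

Lemma chart_inv_continuous i p : chart_dom i p ->
  {for chart_map i p, continuous (chart_inv i)}.
Proof. by case: M i p. Qed.

(** A point near the image of [p] comes from the chart domain since the full image is open, and its
    preimage lies in [W] by continuity of the inverse chart. *)
Lemma open_chart_image_setI i (W : set M) : open W ->
  open (chart_map i @` (chart_dom i `&` W)).
Proof.
move=> Wop; rewrite openE => _ [p [ip Wp] <-].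
have im : \forall y \near chart_map i p, (chart_map i @` chart_dom i) y.
  by apply: open_nbhs_nbhs; split; [exact: open_chart_image|exists p].
have Wim : \forall y \near chart_map i p, W (chart_inv i y).
  apply: (chart_inv_continuous ip); rewrite chart_mapK //.
  exact: open_nbhs_nbhs.
apply: filterS2 im Wim => y [q iq <-]; rewrite chart_mapK // => Wq.
by exists q.
Qed.

Variable g : metric M.

Lemma gram_sym i p u v : chart_dom i p ->
  form (gram g i p) u v = form (gram g i p) v u.
Proof. by move=> ip; case: g => G Gs ? ? ?; exact: Gs. Qed.

Lemma gram_pos i p u : chart_dom i p -> u != 0 ->
  0 < form (gram g i p) u u.
Proof. by move=> ip; case: g => G ? Gp ? ?; exact: Gp. Qed.

Lemma smooth_gloc i : smooth_on (chart_map i @` chart_dom i) (gloc i g).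
Proof. by case: g => G ? ? ? Gs; exact: Gs. Qed.

End Charts.

Theorem theorem3p1 (R : realType) (m : nat) (M : manifold R m) (g : metric M)
    (d1 d2 : R) (X : vfield M) (hX : smooth_vfield setT X)
    (W : set M) (hW : open W) (e : 'I_m -> vfield M)
    (he : orthonormal_frame g W e)
    (p : M) (hp : W p) (i : chart_index M) (hi : chart_dom i p) :
  let G := gloc i g in
  let E := fun a => vloc i (e a) in
  let Y := vloc i X in
  let D := nabla G in
  let Rm := curv G in
  let L := rough_laplacian G E in
  let SX := S_field G E Y in
  let x := chart_map i p in
  let z := sloc i X x in
  tau_delta G (sasaki G) E (sloc i X) d1 d2 x =
    vlift z
      (- (d1 *: L Y x) - d2 *: L (L Y) x
       - d2 *: \sum_a (nabla_curv G (E a) (E a) SX Y x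
                       + Rm (E a) (D (E a) SX) Y x
                       + 2 *: Rm (E a) SX (D (E a) Y) x))
    + hlift G z
      (- (d1 *: SX x) - d2 *: L SX x - d2 *: Rm Y (L Y) SX x
       + d2 *: \sum_a (Rm Y (D (E a) (L Y)) (E a) x
                       - Rm (D (E a) Y) (L Y) (E a) x
                       - Rm (E a) SX (E a) x
                       - nabla_curv G SX (D (E a) Y) Y (E a) x
                       + Rm Y (D (E a) Y) (D (E a) SX) x
                       - Rm Y (Rm (E a) SX Y) (E a) x)).
Proof.
pose cR := curvature (Gamma (gloc i g)); pose nR := dcurvature (Gamma (gloc i g)).
(* The frame is controlled on [W] only, so the chart image is cut down to the part lying over
   [W]. *)
pose U := chart_map i @` (chart_dom i `&` W).
have Uop : open U by exact: open_chart_image_setI.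
have sub : U `<=` chart_map i @` chart_dom i by move=> _ [q [iq _] <-]; exists q.
have invU y : U y -> chart_dom i (chart_inv i y).
  by move=> [q [iq _] <-]; rewrite chart_mapK.
move=> G E Y D Rm L SX x z.
have Ux : U x by exists p.
have sG : smooth U G.
  exact/(smooth_on_smooth Uop)/(smooth_on_subset sub)/smooth_gloc.
have Gsym y : U y -> forall u v, form (G y) u v = form (G y) v u.
  by move=> /invU iy u v; exact: gram_sym.
have Gpos y : U y -> forall u, u != 0 -> 0 < form (G y) u u.
  by move=> /invU iy u; exact: gram_pos.
have sY : smooth U Y.
  apply/(smooth_on_smooth Uop)/(smooth_on_subset _ (hX i)).
  by move=> _ [q [iq _] <-]; exists q.
have sE a : smooth U (E a) by exact: (smooth_on_smooth Uop (he.1 a i)).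
(* The base part of [sloc i X] is the chart composed with its inverse, which is the identity only on
   the chart image. *)
have FE y : U y -> sloc i X y = row_mx y (Y y).
  by move=> [q [iq _] <-]; congr row_mx; rewrite /= chart_mapK.
have GamP := metric_conn (levi_civita Uop sG Gsym Gpos).
have sL := smooth_rough_laplacian Uop sG Gsym Gpos sE.
have sS : smooth U SX by exact: (smooth_S_field Uop sG Gsym Gpos).
have sN a Z : smooth U Z -> smooth U (D (E a) Z).
  by move=> sZ; rewrite /D nablaE; exact: (smooth_nabla GamP).
(* In the last horizontal term a curvature field is an argument of another curvature, which
   differentiates it; its smoothness is what lets [curvE] apply to the outer one. *)
have sR a : smooth U (Rm (E a) SX Y).
  apply: (smooth_eq Uop (fun y Uy => esym (curvE GamP (sE a) sS sY Uy))).
  exact: (smooth_curvature_pull GamP Uop (fun x Dx => Dx) (smooth_id U)).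
rewrite /tau_delta (tension_lift Uop sG Gsym Gpos sY FE sE Ux).
rewrite (bitension_lift Uop sG Gsym Gpos sY FE sE Ux) /z (FE x Ux).
rewrite (lift_combination Uop sG Gsym Gpos).
have NE a Z : D (E a) Z x = pcov (Gamma G) id (E a x) Z x by rewrite /D nablaE.
have vE a : nabla_curv G (E a) (E a) SX Y x + Rm (E a) (D (E a) SX) Y x
    + 2 *: Rm (E a) SX (D (E a) Y) x = nR x (E a x) (E a x) (SX x) (Y x)
    + cR x (E a x) (pcov (Gamma G) id (E a x) SX x) (Y x)
    + 2 *: cR x (E a x) (SX x) (pcov (Gamma G) id (E a x) Y x).
  rewrite (nabla_curvE GamP (sE a) (sE a) sS sY Ux) -!NE.
  rewrite [Rm _ _ _ _](curvE GamP (sE a) (sN a _ sS) sY Ux).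
  by rewrite [Rm _ _ _ _](curvE GamP (sE a) sS (sN a _ sY) Ux).
have hE a : Rm Y (D (E a) (L Y)) (E a) x - Rm (D (E a) Y) (L Y) (E a) x
    - Rm (E a) SX (E a) x - nabla_curv G SX (D (E a) Y) Y (E a) x
    + Rm Y (D (E a) Y) (D (E a) SX) x - Rm Y (Rm (E a) SX Y) (E a) x =
    cR x (Y x) (pcov (Gamma G) id (E a x) (L Y) x) (E a x)
    - cR x (pcov (Gamma G) id (E a x) Y x) (L Y x) (E a x)
    - cR x (E a x) (SX x) (E a x)
    - nR x (SX x) (pcov (Gamma G) id (E a x) Y x) (Y x) (E a x)
    + cR x (Y x) (pcov (Gamma G) id (E a x) Y x) (pcov (Gamma G) id (E a x) SX x)
    - cR x (Y x) (cR x (E a x) (SX x) (Y x)) (E a x).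
  rewrite (nabla_curvE GamP sS (sN a _ sY) sY (sE a) Ux) -!NE.
  have -> : Rm Y (D (E a) (L Y)) (E a) x = _ :=
    curvE GamP sY (sN a _ (sL _ sY)) (sE a) Ux.
  have -> : Rm (D (E a) Y) (L Y) (E a) x = _ :=
    curvE GamP (sN a _ sY) (sL _ sY) (sE a) Ux.
  have -> : Rm (E a) SX (E a) x = _ := curvE GamP (sE a) sS (sE a) Ux.
  have -> : Rm Y (D (E a) Y) (D (E a) SX) x = _ :=
    curvE GamP sY (sN a _ sY) (sN a _ sS) Ux.
  have -> : Rm Y (Rm (E a) SX Y) (E a) x = _ := curvE GamP sY (sR a) (sE a) Ux.
  by have -> : Rm (E a) SX Y x = _ := curvE GamP (sE a) sS sY Ux.
have rE : Rm Y (L Y) SX x = _ := curvE GamP sY (sL _ sY) sS Ux.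
(* The final [addrC] reconciles the order of the lifts: horizontal first in the lemmas, vertical
   first in the statement. *)
rewrite (eq_bigr _ (fun a _ => vE a)) (eq_bigr _ (fun a _ => hE a)) rE addrC.
have combV (a b c : 'rV[R]_m) :
    d1 *: - a + d2 *: (- b - c) = - (d1 *: a) - d2 *: b - d2 *: c by row_ring.
have combH (a b c u : 'rV[R]_m) : d1 *: - a + d2 *: (- b - c + u) =
    - (d1 *: a) - d2 *: b - d2 *: c + d2 *: u by row_ring.
by congr (vlift _ _ + hlift _ _ _); [exact: combV|exact: combH].
Qed.
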